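(* Let $H$ be an étale groupoid with locally compact, Hausdorff unit space $X$. The inclusion $C_0(X)\subseteq C^*(H)$ has the generalised intersection property with hidden ideal $\mathcal{N}_{EL}$ if and only if $H$ is topologically free.
   Context: All ideals are closed and two-sided. An étale groupoid is a topological groupoid whose range and source maps $r,s$ are local homeomorphisms; $H$ itself need not be Hausdorff. A bisection is an open subset $U\subseteq H$ such that $r|_U$ and $s|_U$ are injective. $H(x)=s^{-1}(x)\cap r^{-1}(x)$ for $x\in X$. $H$ is topologically free if for every bisection $U\subseteq H\setminus X$ the set $\{x\in X:H(x)\cap U\ne\emptyset\}$ has empty interior in $X$. For a bisection $U$ (which is locally compact Hausdorff), functions in $C_c(U)$ are extended by $0$ to $H$. Let $\mathfrak{S}(H)$ be the linear span of $C_c(U)$ over all bisections $U$, a $*$-algebra for $(f*g)(\gamma)=\sum_{r(\eta)=r(\gamma)}f(\eta)g(\eta^{-1}\gamma)$ and $f^*(\gamma)=\overline{f(\gamma^{-1})}$. $C^*(H)$ is its maximal $C^*$-completion; it contains $C_0(X)$. (For any unital inverse semigroup $S$ of bisections of $H$ such that $\bigcup S=H$ and $U\cap V$ is a union of elements of $S$ for all $U,V\in S$, $C^*(H)$ is canonically isomorphic to the crossed product $C_0(X)\rtimes S$.) $\mathcal{M}_{\mathrm{loc}}(C_0(X))$ is the local multiplier algebra, that is, the $C^*$-inductive limit of $C_b(V)$ over the dense open subsets $V\subseteq X$. The canonical map $EL\colon C^*(H)\to\mathcal{M}_{\mathrm{loc}}(C_0(X))$ is the unique contractive linear map such that, for every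 bisection $U$ and $f\in C_c(U)$, $EL(f)$ is the class of the function on the dense open set $(U\cap X)\cup(X\setminus\overline{U\cap X})$ that equals $f$ on $U\cap X$ and $0$ on $X\setminus\overline{U\cap X}$. $\mathcal{N}_{EL}$ is the largest ideal of $C^*(H)$ contained in $\ker EL$. An inclusion $A\subseteq B$ of $C^*$-algebras has the generalised intersection property if among the ideals $J$ of $B$ with $J\cap A=0$ there is a unique maximal one; this is called the hidden ideal. *)

(* Defs.v *)
From HB Require Import structures.
From mathcomp Require Import all_boot all_order all_algebra complex.
From mathcomp Require Import all_classical all_reals all_analysis.

Set Implicit Arguments.
Unset Strict Implicit.
Unset Printing Implicit Defensive.

Import Order.TTheory GRing.Theory Num.Theory.
Import numFieldNormedType.Exports.

Local Open Scope classical_set_scope.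
Local Open Scope ring_scope.

(* Declared as a [numClosedFieldType] so that the field R[i] receives the norm
   topology that MathComp-Analysis puts on every such type.  Norms of complex
   normed spaces take their values in [Cplx R]; 0 <= z there means that z is
   real and nonnegative. *)
Definition Cplx (R : realType) : numClosedFieldType := R[i].

(* Not necessarily unital, so the MathComp ring structures do not apply. *)
Record cstarAlgebra (R : realType) := CstarAlgebra {
  cstar_sort :> completeNormedModType (Cplx R);
  cmul : cstar_sort -> cstar_sort -> cstar_sort;
  cstar : cstar_sort -> cstar_sort;
  cmulA : forall a b c, cmul a (cmul b c) = cmul (cmul a b) c;
  cmul_linearl : forall (z : Cplx R) a b c,
    cmul (z *: a + b) c = z *: cmul a c + cmul b c;
  cmul_linearr : forall (z : Cplx R) a b c,
    cmul c (z *: a + b) = z *: cmul c a + cmul c b;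
  cmul_norm : forall a b, `|cmul a b| <= `|a| * `|b|;
  cstarK : forall a, cstar (cstar a) = a;
  cstar_antilinear : forall (z : Cplx R) a b,
    cstar (z *: a + b) = z^* *: cstar a + cstar b;
  cstarM : forall a b, cstar (cmul a b) = cmul (cstar b) (cstar a);
  cstar_identity : forall a, `|cmul (cstar a) a| = `|a| ^+ 2
}.

Record closed_ideal (R : realType) (B : cstarAlgebra R) (J : set B) : Prop :=
{ ideal_closed : closed J;
  ideal0 : J 0;
  ideal_linear : forall (z : Cplx R) a b, J a -> J b -> J (z *: a + b);
  ideal_mull : forall a b, J b -> J (cmul a b);
  ideal_mulr : forall a b, J a -> J (cmul a b) }.

Definition largest_ideal_in (R : realType) (B : cstarAlgebra R)
    (K N : set B) : Prop :=
  [/\ closed_ideal N, N `<=` K &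
      forall J : set B, closed_ideal J -> J `<=` K -> J `<=` N].

Section GeneralisedIntersectionProperty.
Context (R : realType) (B : cstarAlgebra R) (A : set B).

Definition trivially_meeting_ideal (J : set B) : Prop :=
  closed_ideal J /\ J `&` A = [set 0].

Definition maximal_trivially_meeting_ideal (J : set B) : Prop :=
  trivially_meeting_ideal J /\
  forall J', trivially_meeting_ideal J' -> J `<=` J' -> J' = J.

Definition generalised_intersection_property : Prop :=
  exists! J, maximal_trivially_meeting_ideal J.

Definition hidden_ideal (N : set B) : Prop :=
  unique maximal_trivially_meeting_ideal N.

End GeneralisedIntersectionProperty.

(* An image of an open subset of [W] is open in [f @` W] iff it is open, as
   [f @` W] is itself open. *)
Definition local_homeomorphism (T U : topologicalType) (f : T -> U) : Prop :=
  forall t, exists W : set T,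
    [/\ open W /\ W t, open (f @` W), set_inj W f,
        (forall w, W w -> {for w, continuous f}) &
        (forall O, open O -> O `<=` W -> open (f @` O))].

(* Arrows act from right to left: [gmul a b] is the product when
   [gsrc a = grng b] and is unconstrained otherwise.  Since [gsrc] is a
   continuous left inverse of the continuous map [gunit], the latter is a
   homeomorphism of [X] onto the set of units with the subspace topology. *)
Record etaleGroupoid (X : topologicalType) := EtaleGroupoid {
  arrow :> topologicalType;
  gsrc : arrow -> X;
  grng : arrow -> X;
  gunit : X -> arrow;
  ginv : arrow -> arrow;
  gmul : arrow -> arrow -> arrow;
  gsrc_unit : forall x, gsrc (gunit x) = x;
  grng_unit : forall x, grng (gunit x) = x;
  gsrc_mul : forall a b, gsrc a = grng b -> gsrc (gmul a b) = gsrc b;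
  grng_mul : forall a b, gsrc a = grng b -> grng (gmul a b) = grng a;
  gmulA : forall a b c, gsrc a = grng b -> gsrc b = grng c ->
    gmul a (gmul b c) = gmul (gmul a b) c;
  gmul1 : forall a, gmul a (gunit (gsrc a)) = a;
  gmul1l : forall a, gmul (gunit (grng a)) a = a;
  gsrc_inv : forall a, gsrc (ginv a) = grng a;
  grng_inv : forall a, grng (ginv a) = gsrc a;
  gmulV : forall a, gmul a (ginv a) = gunit (grng a);
  gmulVl : forall a, gmul (ginv a) a = gunit (gsrc a);
  gunit_continuous : continuous gunit;
  ginv_continuous : continuous ginv;
  gmul_continuous :
    {within [set p : arrow * arrow | gsrc p.1 = grng p.2],
     continuous (fun p => gmul p.1 p.2)};
  gsrc_local_homeo : local_homeomorphism gsrc;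
  grng_local_homeo : local_homeomorphism grng
}.

Section Groupoid.
Context (R : realType) (X : topologicalType) (H : etaleGroupoid X).
Local Notation C := (Cplx R).

Definition bisection (U : set H) : Prop :=
  [/\ open U, set_inj U (@grng X H) & set_inj U (@gsrc X H)].

Definition unit_arrows : set H := range (@gunit X H).

Definition isotropy (x : X) : set H := [set a | gsrc a = x /\ grng a = x].

Definition topologically_free : Prop :=
  forall U : set H, bisection U -> U `<=` ~` unit_arrows ->
    interior [set x : X | isotropy x `&` U !=set0] = set0.

(* [f] is already extended by zero to [H]; as [U] is open, continuity of
   [f] restricted to [U] is continuity of [f] at the points of [U]. *)
Definition Cc (U : set H) (f : H -> C) : Prop :=
  (forall a, U a -> {for a, continuous f}) /\
  exists2 K : set H, compact K /\ K `<=` U & forall a, ~ K a -> f a = 0.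

Definition quasi_continuous (f : H -> C) : Prop :=
  exists (n : nat) (U : 'I_n -> set H) (c : 'I_n -> C) (F : 'I_n -> H -> C),
    (forall i, bisection (U i) /\ Cc (U i) (F i)) /\
    f = (fun a => \sum_(i < n) c i * F i a).

(* For [quasi_continuous] f and g the sum has finitely many nonzero terms. *)
Definition convolution (f g : H -> C) : H -> C :=
  fun a => \sum_(b \in [set b : H | grng b = grng a]) f b * g (gmul (ginv b) a).

Definition invol (f : H -> C) : H -> C := fun a => (f (ginv a))^*.

Record cstar_seminorm (p : (H -> C) -> C) : Prop :=
{ seminorm_ge0 : forall f, quasi_continuous f -> 0 <= p f;
  seminormZ : forall (z : C) f, quasi_continuous f ->
    p (fun a => z * f a) = `|z| * p f;
  seminormD : forall f g, quasi_continuous f -> quasi_continuous g ->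
    p (fun a => f a + g a) <= p f + p g;
  seminormM : forall f g, quasi_continuous f -> quasi_continuous g ->
    p (convolution f g) <= p f * p g;
  seminorm_cstar : forall f, quasi_continuous f ->
    p (convolution (invol f) f) = p f ^+ 2 }.

End Groupoid.

(* [phi] is a *-homomorphism into [B] from the *-algebra of functions [D] with
   product [mul] and involution [star]; its values off [D] are irrelevant. *)
Record star_hom_on (R : realType) (T : Type) (B : cstarAlgebra R)
    (D : set (T -> Cplx R))
    (mul : (T -> Cplx R) -> (T -> Cplx R) -> T -> Cplx R)
    (star : (T -> Cplx R) -> T -> Cplx R)
    (phi : (T -> Cplx R) -> B) : Prop :=
{ hom_linear : forall (z : Cplx R) f g, D f -> D g ->
    phi (fun t => z * f t + g t) = z *: phi f + phi g;
  hom_mul : forall f g, D f -> D g -> phi (mul f g) = cmul (phi f) (phi g);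
  hom_star : forall f, D f -> phi (star f) = cstar (phi f) }.

(* [B], with [iota], is the completion of the *-algebra of [quasi_continuous]
   functions in its largest C*-seminorm, which is [`|iota f|]. *)
Record is_max_completion (R : realType) (X : topologicalType)
    (H : etaleGroupoid X) (B : cstarAlgebra R)
    (iota : (H -> Cplx R) -> B) : Prop :=
{ completion_hom :
    star_hom_on (@quasi_continuous R X H) (@convolution R X H) (@invol R X H) iota;
  completion_dense : dense (iota @` @quasi_continuous R X H);
  completion_max : forall p, cstar_seminorm p ->
    forall f, quasi_continuous f -> p f <= `|iota f| }.

Section FunctionsOnUnitSpace.
Context (R : realType) (X : topologicalType).
Local Notation C := (Cplx R).

Definition C0 (h : X -> C) : Prop :=
  continuous h /\
  forall e : C, 0 < e ->
    exists2 K : set X, compact K & forall x, ~ K x -> `|h x| < e.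

(* Values of [g] off [V] are irrelevant. *)
Definition Cb (V : set X) (g : X -> C) : Prop :=
  (forall x, V x -> {for x, continuous g}) /\
  exists M : C, forall x, V x -> `|g x| <= M.

Definition dense_open (V : set X) : Prop := open V /\ dense V.

(* The copy of C_0(X) in the completion: [b] is the image of [h] under the
   continuous extension of [iota] from the functions in C_c of the unit
   space, which are uniformly dense in C_0(X). *)
Definition C0_image (H : etaleGroupoid X) (B : cstarAlgebra R)
    (iota : (H -> C) -> B) : set B :=
  [set b | exists2 h : X -> C, C0 h &
     forall e : C, 0 < e -> exists f : H -> C,
       [/\ Cc (@unit_arrows X H) f, forall x, `|h x - f (gunit H x)| <= e &
           `|b - iota f| <= e]].

(* [M], with the maps [j V] from C_b(V), is the C*-inductive limit of the
   C_b(V) over dense open [V] along restriction.  Restriction to a smaller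
   dense open set preserves the sup norm, so the limit norm of the class of
   [g] is its sup norm over [V]. *)
Record is_local_multiplier_algebra (M : cstarAlgebra R)
    (j : set X -> (X -> C) -> M) : Prop :=
{ mloc_hom : forall V, dense_open V ->
    star_hom_on (Cb V) (fun g h x => g x * h x) (fun g x => (g x)^*) (j V);
  mloc_restrict : forall V W g h, dense_open V -> dense_open W -> W `<=` V ->
    Cb V g -> Cb W h -> (forall x, W x -> g x = h x) -> j V g = j W h;
  mloc_norm : forall V g (c : C), dense_open V -> Cb V g -> 0 <= c ->
    `|j V g| <= c <-> (forall x, V x -> `|g x| <= c);
  mloc_dense : dense [set m | exists V g, [/\ dense_open V, Cb V g & m = j V g]]
}.

Record is_EL (H : etaleGroupoid X) (B M : cstarAlgebra R)
    (iota : (H -> C) -> B) (j : set X -> (X -> C) -> M)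
    (EL : B -> M) : Prop :=
{ EL_linear : forall (z : C) a b, EL (z *: a + b) = z *: EL a + EL b;
  EL_contractive : forall a, `|EL a| <= `|a|;
  EL_Cc : forall (U : set H) f, bisection U -> Cc U f ->
    let UX := gunit H @^-1` U in
    EL (iota f) =
      j (UX `|` ~` closure UX) (fun x => if x \in UX then f (gunit H x) else 0)
}.

End FunctionsOnUnitSpace.

(* Main.v *)
Require Import Defs.
From HB Require Import structures.
From mathcomp Require Import all_boot all_order all_algebra complex.
From mathcomp Require Import all_classical all_reals all_analysis.
From mathcomp Require Import ring lra.
Import Order.TTheory GRing.Theory Num.Theory.
Import numFieldNormedType.Exports.
Local Open Scope classical_set_scope.
Local Open Scope ring_scope.

Set Implicit Arguments.
Unset Strict Implicit.
Unset Printing Implicit Defensive.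

(** Write A for the copy of C_0(X) in B, and call an ideal J of B trivially
    meeting when J meets A in 0 only.  Both directions compare trivially
    meeting ideals with the kernel of EL.

    Elements of J stay far from A: if h lies in C_c(X) and b in J, then
    |h(x)| <= |h - b| for all x ([trivially_meeting_dist]).  Otherwise pick t
    with |h - b| < t < |h(x)| and a bump function g supported where |h| > t;
    the powers (h - b)^n agree with h^n modulo J, and g = (g / h^n) h^n with
    |g / h^n| <= t^-n, so g is a limit of elements of J, hence lies in J and
    in A, hence is 0.  No quotient C*-algebra is formed.  The argument
    only uses that C_c(X) maps boundedly to B ([embed_norm]), which follows from
    the C*-identity applied to functions w such that 1 + w is unimodular.

    If H is topologically free, then every quasi-continuous function f vanishes
    on the non-unit arrows that start and end in some nonempty open W inside
    any given nonempty open set ([quasi_continuous_vanishing]).  Cutting f down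
    by a bump function k supported in W thus gives the function k f k on the
    unit space, whose values are those of EL(f).  If b in J is close to f and
    EL(b) is not 0, then k f k is large and close to the element k b k of J,
    against the distance estimate.  So trivially meeting ideals lie in ker EL,
    therefore in N_EL, which itself meets A trivially because EL is isometric
    on C_c(X); N_EL is then the largest trivially meeting ideal
    ([free_hidden_ideal]).

    If H is not topologically free, there is a bisection of non-unit isotropy
    arrows over a nonempty open V in X.  Let functions on H act on finitely
    supported functions on X by (f xi)(y) = sum of f(a) xi(s(a)) over the arrows
    a with r(a) = y.  The l^2 operator norm of this action is a C*-seminorm
    ([orbit_cstar_seminorm]), so it is dominated by the norm of B and the
    action has a kernel in B; the kernel meets A trivially
    ([orbit_kernel_trivially_meeting]) as functions on X act by multiplication.
    A function in C_c(V) and its copy on the bisection act in the same way, but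
    EL sees only the former; their difference is in the kernel of the action and
    not in ker EL ([orbit_kernel_not_in_EL_kernel]).  A maximal trivially meeting
    ideal containing the kernel, which exists by Zorn's lemma
    ([trivially_meeting_maximal]), therefore differs from N_EL. *)

(** * Real and complex scalars *)

Section RealPart.
Context {R : realType}.
Local Notation C := (Cplx R).

Definition ofR (x : R) : C := (x%:C)%C.
Definition reC (z : C) : R := complex.Re z.

Lemma ofRD x y : ofR (x + y) = ofR x + ofR y.
Proof. exact: (rmorphD (real_complex R)). Qed.
Lemma ofRM x y : ofR (x * y) = ofR x * ofR y.
Proof. exact: (rmorphM (real_complex R)). Qed.
Lemma ofRN x : ofR (- x) = - ofR x.
Proof. exact: (rmorphN (real_complex R)). Qed.
Lemma ofRB x y : ofR (x - y) = ofR x - ofR y.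
Proof. exact: (rmorphB (real_complex R)). Qed.
Lemma ofR0 : ofR 0 = 0. Proof. by []. Qed.
Lemma ofR1 : ofR 1 = 1. Proof. by []. Qed.
Lemma ofRX x n : ofR (x ^+ n) = ofR x ^+ n.
Proof. exact: (rmorphXn (real_complex R)). Qed.
Lemma ofR_nat n : ofR n%:R = n%:R.
Proof. exact: (rmorph_nat (real_complex R)). Qed.
Lemma ofRK x : reC (ofR x) = x. Proof. by []. Qed.
Lemma ofR_le x y : (ofR x <= ofR y) = (x <= y).
Proof. exact: lecR. Qed.
Lemma ofR_lt x y : (ofR x < ofR y) = (x < y).
Proof. exact: ltcR. Qed.
Lemma reCK (z : C) : z \is Num.real -> ofR (reC z) = z.
Proof. exact: RRe_real. Qed.
Lemma reCB (x y : C) : reC (x - y) = reC x - reC y.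
Proof. by case: x y => a b []. Qed.
Lemma ofR_real x : ofR x \is Num.real.
Proof. by apply/complex_realP; exists x. Qed.
Lemma ofR_norm x : `|ofR x| = ofR `|x|.
Proof.
have [x0|/ltW x0] := lerP 0 x.
  by rewrite !ger0_norm // -ofR0 ofR_le.
by rewrite !ler0_norm ?ofRN // -ofR0 ofR_le.
Qed.
Lemma ofR_conj x : (ofR x)^* = ofR x.
Proof. exact/CrealP/ofR_real. Qed.
Lemma reC_norm (z : C) : `|reC z| <= reC `|z|.
Proof. by rewrite -ofR_le reCK ?normr_real//; exact: normc_ge_Re. Qed.

Lemma normr_ofR (V : normedZmodType C) (a : V) : `|a| = ofR (reC `|a|).
Proof. by rewrite reCK// normr_real. Qed.
Lemma reC_norm_ge0 (V : normedZmodType C) (a : V) : 0 <= reC `|a|.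
Proof. by rewrite -ofR_le -normr_ofR ofR0. Qed.

Lemma continuous_at_ofR (T : topologicalType) (f : T -> R) x :
  {for x, continuous f} -> {for x, continuous (ofR \o f)}.
Proof.
move=> fc; apply/cvgrPdist_lt => e e0 /=.
have eE : e = ofR (reC e) by rewrite reCK// gtr0_real.
move/cvgrPdist_lt: fc => /(_ (reC e)); rewrite -ofR_lt -eE => /(_ e0).
apply: filterS => t; by rewrite -ofRB ofR_norm eE ofR_lt.
Qed.

Lemma continuous_at_reC (T : topologicalType) (f : T -> C) x :
  {for x, continuous f} -> {for x, continuous (reC \o f)}.
Proof.
move=> fc; apply/cvgrPdist_lt => e e0 /=.
move/cvgrPdist_lt: fc => /(_ (ofR e)); rewrite -ofR0 ofR_lt => /(_ e0).
apply: filterS => t; rewrite -reCB -(@reCK `|_|) ?normr_real// ofR_lt.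
exact/le_lt_trans/reC_norm.
Qed.

Lemma compact_norm_bounded (T : topologicalType) (f : T -> C) (K : set T) :
  compact K -> (forall x, K x -> {for x, continuous f}) ->
  exists2 m : R, 0 <= m & forall x, K x -> `|f x| <= ofR m.
Proof.
move=> cK fc.
have cim : compact ((reC \o (fun t => `|f t|)) @` K).
  apply: continuous_compact => //; apply: continuous_in_subspaceT => x /set_mem Kx.
  apply: continuous_at_reC. apply: cvg_norm. exact: fc.
have [m [mr mP]] := compact_bounded cim.
exists (Num.max (m + 1) 0); first by rewrite le_max lexx orbT.
move=> x Kx; rewrite -(@reCK `|_|) ?normr_real// ofR_le.
apply: le_trans (_ : _ <= m + 1) _; last by rewrite le_max lexx.
apply: le_trans (ler_norm _) _; apply: mP; last by exists x.
by rewrite ltrDl.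
Qed.

End RealPart.

(** * Topology of etale groupoids *)

Section LocalHomeomorphism.
Context (T U : topologicalType) (f : T -> U) (f_lh : local_homeomorphism f).

Lemma local_homeo_continuous : continuous f.
Proof. by move=> t; have [W [[_ Wt] _ _ + _]] := f_lh t; apply. Qed.

Lemma local_homeo_open O : open O -> open (f @` O).
Proof.
move=> oO; rewrite openE => _ [t Ot <-].
have [W [[oW Wt] _ _ _ fo]] := f_lh t.
apply: (@filterS _ _ _ (f @` (O `&` W))).
  by apply: image_subset; exact: subIsetl.
apply: open_nbhs_nbhs; split; last by exists t.
by apply: fo; [exact: openI | exact: subIsetr].
Qed.

(** The inverse of a local homeomorphism on a set where it is injective; the
    map [d] supplies the values off the image. *)
Lemma local_section (d : U -> T) (O : set T) : open O -> set_inj O f ->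
  exists sg : U -> T,
    [/\ forall x, (f @` O) x -> O (sg x) /\ f (sg x) = x,
        forall t, O t -> sg (f t) = t &
        forall x, (f @` O) x -> {for x, continuous sg}].
Proof.
move=> oO fi; pose sg x := xget (d x) [set t | O t /\ f t = x].
have sgP x : (f @` O) x -> O (sg x) /\ f (sg x) = x.
  by move=> [t Ot ft]; rewrite /sg; case: xgetP => [y _ []//|/(_ t)[]].
have sgK t : O t -> sg (f t) = t.
  move=> Ot; have [] : O (sg (f t)) /\ f (sg (f t)) = f t by apply: sgP; exists t.
  by move=> Os /fi; apply; exact/mem_set.
exists sg; split => // x [t Ot <-] A; rewrite (sgK _ Ot) => At.
have := nbhs_interior At; rewrite /= => At'.
apply: (@filterS _ _ _ (f @` (O `&` A°))).
  by move=> _ [u [Ou Au] <-]; rewrite /= (sgK _ Ou); exact: interior_subset.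
apply: open_nbhs_nbhs; split; last by exists t => //; split => //; exact: nbhs_singleton.
by apply: local_homeo_open; apply: openI => //; exact: open_interior.
Qed.

End LocalHomeomorphism.

Lemma closed_equaliser (S T : topologicalType) (f g : S -> T) :
  hausdorff_space T -> continuous f -> continuous g ->
  closed [set x | f x = g x].
Proof.
move=> hT fc gc x clx; apply: contrapT => /eqP fgx.
move: hT; rewrite open_hausdorff => /(_ _ _ fgx) [[P Q]] /= [/set_mem Pf /set_mem Qg] [oP oQ /eqP PQ].
have fP : nbhs x (f @^-1` P) by apply: fc; exact: open_nbhs_nbhs.
have gQ : nbhs x (g @^-1` Q) by apply: gc; exact: open_nbhs_nbhs.
have [y [/= e [/= Py Qy]]] := clx _ (filterI fP gQ).
by have : (P `&` Q) (f y) by [split => //; rewrite e]; rewrite PQ.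
Qed.

Section GroupoidTopology.
Context (X : topologicalType) (H : etaleGroupoid X).
Local Notation s := (@gsrc X H).
Local Notation r := (@grng X H).
Local Notation unit := (@gunit X H).

Lemma gsrc_continuous : continuous s.
Proof. exact/local_homeo_continuous/gsrc_local_homeo. Qed.
Lemma grng_continuous : continuous r.
Proof. exact/local_homeo_continuous/grng_local_homeo. Qed.
Lemma gsrc_open O : open O -> open (s @` O).
Proof. exact/local_homeo_open/gsrc_local_homeo. Qed.
Lemma grng_open O : open O -> open (r @` O).
Proof. exact/local_homeo_open/grng_local_homeo. Qed.

Lemma ginv_unit x : ginv (unit x) = unit x.
Proof.
have := gmul1l (ginv (unit x)); rewrite grng_inv gsrc_unit gmulV => <-.
by rewrite grng_unit.
Qed.

Lemma gmulKV (a c : H) : s a = r c -> gmul (ginv a) (gmul a c) = c.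
Proof.
by move=> ac; rewrite gmulA ?gsrc_inv// gmulVl ac gmul1l.
Qed.

Lemma gmulVK (a c : H) : r a = r c -> gmul a (gmul (ginv a) c) = c.
Proof.
by move=> ac; rewrite gmulA ?gsrc_inv ?grng_inv// gmulV ac gmul1l.
Qed.

Lemma ginvK (a : H) : ginv (ginv a) = a.
Proof.
have e : s (ginv a) = r a by rewrite gsrc_inv.
have := gmulKV e; rewrite gmulVl.
have <- : s (ginv (ginv a)) = s a by rewrite gsrc_inv grng_inv.
by rewrite gmul1.
Qed.

Lemma unit_arrowsP (a : H) : unit_arrows a <-> unit (s a) = a.
Proof.
by split=> [[x _ <-]|<-]; [rewrite gsrc_unit | exists (s a)].
Qed.

(** Near a unit, an injectivity neighbourhood [W] of the source map contains
    both [a] and the unit at the source of [a], which forces them to agree. *)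
Lemma unit_arrows_open : open (@unit_arrows X H).
Proof.
rewrite openE => _ [x _ <-].
have [W [[oW Wt] _ si _ _]] := gsrc_local_homeo (unit x).
apply: (@filterS _ _ _ (W `&` (unit \o s) @^-1` W)).
  move=> a [/= Wa Wu]; apply/unit_arrowsP; apply: si; rewrite ?inE//.
  by rewrite gsrc_unit.
apply: open_nbhs_nbhs; split; last by split => //=; rewrite gsrc_unit.
apply: openI => //; apply: open_comp => // a _.
by apply: continuous_comp; [exact: gsrc_continuous | exact: gunit_continuous].
Qed.

Lemma unit_arrows_bisection : bisection (@unit_arrows X H).
Proof.
split; first exact: unit_arrows_open.
- by move=> _ _ /set_mem [x _ <-] /set_mem [y _ <-]; rewrite !grng_unit => ->.
- by move=> _ _ /set_mem [x _ <-] /set_mem [y _ <-]; rewrite !gsrc_unit => ->.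
Qed.

Lemma bisectionS (U V : set H) : bisection U -> open V -> V `<=` U -> bisection V.
Proof.
move=> [_ ri si] oV VU; split=> // a b /set_mem /VU /mem_set Ua /set_mem /VU /mem_set Ub.
- exact: ri.
- exact: si.
Qed.

Lemma bisection_section (U : set H) : bisection U ->
  exists sg : X -> H,
    [/\ forall x, (s @` U) x -> U (sg x) /\ s (sg x) = x,
        forall a, U a -> sg (s a) = a &
        forall x, (s @` U) x -> {for x, continuous sg}].
Proof.
by move=> [oU _ si]; exact: (local_section (@gsrc_local_homeo X H) unit oU si).
Qed.

Definition bisection_mul (U V : set H) : set H :=
  [set a | exists b c, [/\ U b, V c, s b = r c & a = gmul b c]].

(** Left division by the arrow of [U] with the same range: since [r] restricts
    to a homeomorphism on [U], the quotient depends continuously on the arrow,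
    and it recovers both factors of a product in [bisection_mul U V]. *)
Lemma bisection_division (U : set H) : bisection U ->
  exists q : H -> H,
    [/\ forall a, (r @` U) (r a) -> U (q a) /\ r (q a) = r a,
        forall a b, U b -> r b = r a -> q a = b,
        forall a, (r @` U) (r a) -> {for a, continuous q} &
        forall a, (r @` U) (r a) ->
          {for a, continuous (fun a => gmul (ginv (q a)) a)}].
Proof.
move=> [oU ri _].
have [sg [sgP sgK sgc]] := local_section (@grng_local_homeo X H) unit oU ri.
have qc a : (r @` U) (r a) -> {for a, continuous (sg \o r)}.
  by move=> rUa; apply: continuous_comp; [exact: grng_continuous | exact: sgc].
exists (sg \o r); split=> // [a /sgP //|a b Ub /= <-|a rUa]; first exact: sgK.
pose p a := (ginv (sg (r a)), a) : H * H.
pose A := [set p : H * H | s p.1 = r p.2].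
have pA b : (r @` U) (r b) -> A (p b).
  by rewrite /A/= gsrc_inv => /sgP[].
have pc : p @ nbhs a --> within A (nbhs (p a)).
  have p0 : p @ nbhs a --> nbhs (p a).
    apply: cvg_pair; last exact: cvg_id.
    by apply: continuous_comp; [exact: (qc a rUa) | exact: ginv_continuous].
  move=> B /= /p0 /=.
  have : nbhs a (r @^-1` (r @` U)).
    by apply: grng_continuous; apply: open_nbhs_nbhs; split => //; exact: grng_open.
  rewrite /nbhs /= => h1 h2.
  apply: filterS (filterI h1 h2) => b [/= rb]; apply; exact: pA.
have /subspace_continuousP /(_ (p a) (pA a rUa)) := @gmul_continuous X H.
exact: (cvg_comp _ _ pc).
Qed.

(** Openness comes from left division: an arrow over [r @` U] is a product
    exactly when its quotient lies in [V]. *)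
Lemma bisection_mulP (U V : set H) : bisection U -> bisection V ->
  bisection (bisection_mul U V).
Proof.
move=> bU [oV riV siV]; have [q [qU qE _ cc]] := bisection_division bU.
have [oU riU siU] := bU.
have E : bisection_mul U V =
    r @^-1` (r @` U) `&` (fun a => gmul (ginv (q a)) a) @^-1` V.
  apply/seteqP; split=> [_ [b [c [Ub Vc bc ->]]]|a [/= ra Va]].
    have e := grng_mul bc.
    split=> /=; first by rewrite e; exists b.
    by rewrite (@qE _ b) ?gmulKV.
  have [Uq rq] := qU _ ra.
  by exists (q a), (gmul (ginv (q a)) a); split; rewrite ?grng_mul ?gsrc_inv ?grng_inv ?gmulVK.
split.
- rewrite E openE => a [ra Va]; apply: filterI.
    by apply: grng_continuous; apply: open_nbhs_nbhs; split => //; exact: grng_open.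
  by apply: cc => //; apply: open_nbhs_nbhs.
- move=> _ _ /set_mem [b [c [Ub Vc bc ->]]] /set_mem [b' [c' [Ub' Vc' bc' ->]]].
  rewrite !grng_mul// => /riU; rewrite !inE => /(_ Ub Ub') e; subst b'.
  by move: bc'; rewrite bc => /riV; rewrite !inE => /(_ Vc Vc') ->.
- move=> _ _ /set_mem [b [c [Ub Vc bc ->]]] /set_mem [b' [c' [Ub' Vc' bc' ->]]].
  rewrite !gsrc_mul// => /siV; rewrite !inE => /(_ Vc Vc') e; subst c'.
  by move: bc; rewrite -bc' => /siU; rewrite !inE => /(_ Ub Ub') ->.
Qed.

Lemma compact_mul (K L : set H) : hausdorff_space X -> compact K -> compact L ->
  compact (bisection_mul K L).
Proof.
move=> hX cK cL; pose A := [set p : H * H | s p.1 = r p.2].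
have -> : bisection_mul K L = (fun p => gmul p.1 p.2) @` ((K `*` L) `&` A).
  apply/seteqP; split=> [_ [b [c [Ub Vc bc ->]]]|_ [[b c] [[/= Kb Lc] bc] <-]].
    by exists (b, c).
  by exists b, c.
apply: continuous_compact.
  by apply: continuous_subspaceW (@gmul_continuous X H); exact: subIsetr.
apply: compact_closedI; first exact: compact_setX.
apply: closed_equaliser => // p; apply: continuous_comp => //.
- exact: cvg_fst.
- exact: gsrc_continuous.
- exact: cvg_snd.
- exact: grng_continuous.
Qed.

End GroupoidTopology.

(** * Finite sums and quasi-continuous functions *)

Lemma finite_subsingleton (T : Type) (A : set T) :
  (forall a b, A a -> A b -> a = b) -> finite_set A.
Proof.
move=> A1; have [[a Aa]|nA] := pselect (exists a, A a).
  by apply: (@sub_finite_set _ _ [set a]) => // b Ab; exact: A1.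
by apply: (@sub_finite_set _ _ set0) => // b Ab; apply: nA; exists b.
Qed.

Section FiniteSums.
Context {K : idomainType}.

Lemma fsum_widen (I : choiceType) (S A : set I) (F : I -> K) :
  S `<=` A -> (forall i, A i -> ~ S i -> F i = 0) ->
  \sum_(i \in A) F i = \sum_(i \in S) F i.
Proof.
by move=> SA F0; apply/esym/fsbig_widen => // i [Ai Si]; exact: F0.
Qed.

Lemma fsum_single (I : choiceType) (A : set I) (i0 : I) (F : I -> K) :
  A i0 -> (forall i, A i -> i <> i0 -> F i = 0) ->
  \sum_(i \in A) F i = F i0.
Proof.
move=> Ai0 F0; rewrite (@fsum_widen _ [set i0]) ?fsbig_set1//.
by move=> _ ->.
Qed.

Lemma fsum_linear (I : choiceType) (A : set I) (z : K) (F G : I -> K) :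
  finite_set [set i | A i /\ F i <> 0] -> finite_set [set i | A i /\ G i <> 0] ->
  \sum_(i \in A) (z * F i + G i) = z * \sum_(i \in A) F i + \sum_(i \in A) G i.
Proof.
move=> fF fG; pose S := [set i | A i /\ F i <> 0] `|` [set i | A i /\ G i <> 0].
have SA : S `<=` A by move=> i [] [].
have fS : finite_set S by rewrite finite_setU.
have F0 i : A i -> ~ S i -> F i = 0.
  by move=> Ai; apply: contra_notP => ?; left.
have G0 i : A i -> ~ S i -> G i = 0.
  by move=> Ai; apply: contra_notP => ?; right.
rewrite !(fsum_widen SA)// ?fsbig_split//= ?mulr_fsumr//.
by move=> i Ai Si; rewrite F0// G0// mulr0 addr0.
Qed.

(** Only the joint support of the summand has to be finite, as the index sets
    will be fibres of an arbitrary groupoid. *)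
Lemma fsum_exchange (I J : choiceType) (A : set I) (B : set J) (F : I -> J -> K) :
  finite_set [set p : I * J | [/\ A p.1, B p.2 & F p.1 p.2 <> 0]] ->
  \sum_(i \in A) \sum_(j \in B) F i j = \sum_(j \in B) \sum_(i \in A) F i j.
Proof.
set S := [set p | _] => fS.
have f1 : finite_set (fst @` S) by exact: finite_image.
have f2 : finite_set (snd @` S) by exact: finite_image.
have s1 : fst @` S `<=` A by move=> _ [p [? ? ?] <-].
have s2 : snd @` S `<=` B by move=> _ [p [? ? ?] <-].
have F0 i j : A i -> B j -> ~ (fst @` S) i \/ ~ (snd @` S) j -> F i j = 0.
  move=> Ai Bj nS; apply: contrapT => Fij.
  by case: nS; apply; exists (i, j).
have e1 : \sum_(i \in A) \sum_(j \in B) F i j =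
    \sum_(i \in fst @` S) \sum_(j \in snd @` S) F i j.
  rewrite (fsum_widen s1) => [|i Ai ni].
    apply: eq_fsbigr => i /set_mem /s1 Ai.
    by apply: fsum_widen => // j Bj nj; apply: F0 => //; right.
  by apply: fsbig1 => j Bj; apply: F0 => //; left.
have e2 : \sum_(j \in B) \sum_(i \in A) F i j =
    \sum_(j \in snd @` S) \sum_(i \in fst @` S) F i j.
  rewrite (fsum_widen s2) => [|j Bj nj].
    apply: eq_fsbigr => j /set_mem /s2 Bj.
    by apply: fsum_widen => // i Ai ni; apply: F0 => //; left.
  by apply: fsbig1 => i Ai; apply: F0 => //; right.
by rewrite e1 e2 exchange_fsbig.
Qed.

(** Turns a sum over the unit space of sums over the arrows at each unit into a
    single sum over all arrows, which can be reindexed by inversion. *)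
Lemma fsum_fibre (I J : choiceType) (p : I -> J) (F : I -> K) :
  finite_set [set i | F i <> 0] ->
  \sum_(j \in [set: J]) \sum_(i \in [set i | p i = j]) F i =
  \sum_(i \in [set: I]) F i.
Proof.
move=> fF.
have e j : \sum_(i \in [set i | p i = j]) F i =
    \sum_(i \in [set: I]) (if p i == j then F i else 0).
  rewrite [RHS](@fsum_widen _ [set i | p i = j])// => [|i _].
    by apply: eq_fsbigr => i /set_mem /= ->; rewrite eqxx.
  by move=> /eqP /negbTE ->.
under eq_fsbigr do rewrite e.
rewrite fsum_exchange.
  apply: eq_fsbigr => i _; rewrite (@fsum_single _ _ (p i)) ?eqxx//.
  by move=> j _ /eqP; rewrite eq_sym => /negbTE ->.
apply: sub_finite_set (finite_image (fun i => (p i, i)) fF) => -[j i] /=.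
by case: eqP => [<- [_ _ Fi]|_ [_ _ []//]]; exists i.
Qed.

End FiniteSums.

Section GroupoidFunctions.
Context {R : realType} {X : topologicalType} {H : etaleGroupoid X}.
Local Notation C := (Cplx R).
Local Notation s := (@gsrc X H).
Local Notation r := (@grng X H).
Local Notation unit := (@gunit X H).
Implicit Types (f g : H -> C) (U V : set H).

Lemma Cc_eq0 U f a : Cc U f -> ~ U a -> f a = 0.
Proof. by move=> [_ [K [_ KU] K0]] Ua; apply: K0 => /KU. Qed.

Lemma Cc_bounded U f : Cc U f ->
  exists2 m : R, 0 <= m & forall a, `|f a| <= ofR m.
Proof.
move=> [fc [K [cK KU] K0]].
have [m m0 mP] := compact_norm_bounded cK (fun a Ka => fc a (KU a Ka)).
exists m => // a; have [/mP//|/K0 ->] := pselect (K a).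
by rewrite normr0 -ofR0 ofR_le.
Qed.

Lemma quasi_continuous_Cc U f : bisection U -> Cc U f -> quasi_continuous f.
Proof.
move=> bU fU; exists 1%N, (fun=> U), (fun=> 1), (fun=> f); split=> //.
by apply/funext => a; rewrite big_ord1 mul1r.
Qed.

Lemma quasi_continuous0 : quasi_continuous (fun _ : H => 0 : C).
Proof.
exists 0%N, (fun=> set0), (fun=> 0), (fun _ _ => 0); split; first by case.
by apply/funext => a; rewrite big_ord0.
Qed.

Lemma quasi_continuous_linear (z : C) f g : quasi_continuous f ->
  quasi_continuous g -> quasi_continuous (fun a => z * f a + g a).
Proof.
move=> [n [U [c [F [FU ->]]]]] [m [V [d [G [GV ->]]]]].
pose glue T (u : 'I_n -> T) (v : 'I_m -> T) i :=
  match fintype.split i with inl k => u k | inr k => v k end.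
exists (n + m)%N, (glue _ U V), (glue _ (fun i => z * c i) d), (glue _ F G).
split=> [i|]; first by rewrite /glue; case: fintype.split.
apply/funext => a; rewrite big_split_ord /= mulr_sumr; congr (_ + _).
- apply: eq_bigr => i _; rewrite /glue.
  by rewrite (unsplitK (inl i : 'I_n + 'I_m)) mulrA.
- apply: eq_bigr => i _; rewrite /glue.
  by rewrite (unsplitK (inr i : 'I_n + 'I_m)).
Qed.

(** Statements that are stable under linear combinations need to be checked on
    a single bisection only. *)
Lemma quasi_continuous_ind (P : (H -> C) -> Prop) :
  P (fun=> 0) ->
  (forall U f, bisection U -> Cc U f -> P f) ->
  (forall (z : C) f g, quasi_continuous f -> quasi_continuous g ->
     P f -> P g -> P (fun a => z * f a + g a)) ->
  forall f, quasi_continuous f -> P f.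
Proof.
move=> P0 PU PD f [n [U [c [F [FU ->]]]]].
suff : P (fun a => \sum_(i < n) c i * F i a) /\
    quasi_continuous (fun a => \sum_(i < n) c i * F i a) by case.
elim: n U c F FU => [|n IH] U c F FU.
  under eq_fun do rewrite big_ord0.
  by split=> //; exact: quasi_continuous0.
under eq_fun do rewrite big_ord_recl.
have [Pn qn] := IH (fun i => U (lift ord0 i)) (fun i => c (lift ord0 i))
  (fun i => F (lift ord0 i)) (fun i => FU _).
have [b0 F0] := FU ord0; split.
- by apply: PD => //; [exact: quasi_continuous_Cc F0 | exact: PU F0].
- by apply: quasi_continuous_linear => //; exact: quasi_continuous_Cc F0.
Qed.

(** What makes the sums over fibres in convolutions and in the orbit
    representation finite: quasi-continuous functions have this property because
    a bisection has at most one arrow with given range or source. *)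
Definition fibre_finite f := forall x,
  finite_set [set a | r a = x /\ f a <> 0] /\
  finite_set [set a | s a = x /\ f a <> 0].

Lemma fibre_finite_linear (z : C) f g : fibre_finite f -> fibre_finite g ->
  fibre_finite (fun a => z * f a + g a).
Proof.
move=> ff fg x; have [fr fs] := ff x; have [gr gs] := fg x.
have sub a : z * f a + g a <> 0 -> f a <> 0 \/ g a <> 0.
  move=> h; have [fa|] := eqVneq (f a) 0; last by move/eqP; left.
  by right=> ga; apply: h; rewrite fa ga mulr0 addr0.
split.
- apply: (@sub_finite_set _ _ ([set a | r a = x /\ f a <> 0] `|` [set a | r a = x /\ g a <> 0])).
    by move=> a [? /sub []]; [left|right].
  by rewrite finite_setU.
- apply: (@sub_finite_set _ _ ([set a | s a = x /\ f a <> 0] `|` [set a | s a = x /\ g a <> 0])).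
    by move=> a [? /sub []]; [left|right].
  by rewrite finite_setU.
Qed.

Lemma fibre_finite_supp U f : bisection U -> (forall a, ~ U a -> f a = 0) ->
  fibre_finite f.
Proof.
move=> [_ ri si] f0 x.
have fU a : f a <> 0 -> a \in U by move=> fa; apply/mem_set; apply: contra_notP fa; exact: f0.
split; apply: finite_subsingleton => a b [ax /fU Ua] [bx /fU Ub].
- by apply: ri; rewrite // ax.
- by apply: si; rewrite // ax.
Qed.

Lemma fibre_finite0 : fibre_finite (fun=> 0).
Proof. by move=> x; split; apply: finite_subsingleton => a b []. Qed.

Lemma quasi_continuous_fibre_finite f : quasi_continuous f -> fibre_finite f.
Proof.
elim/quasi_continuous_ind => [|U {}f bU fU|z {}f g _ _]; first exact: fibre_finite0.
- by apply: (fibre_finite_supp bU) => a; exact: (Cc_eq0 fU).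
- exact: fibre_finite_linear.
Qed.

Lemma convolution_linearl (z : C) f g h : fibre_finite f -> fibre_finite g ->
  convolution (fun a => z * f a + g a) h =
  (fun a => z * convolution f h a + convolution g h a).
Proof.
move=> ff fg; apply/funext => a; rewrite /convolution -fsum_linear.
- by apply: eq_fsbigr => b _; rewrite mulrDl mulrA.
- apply: sub_finite_set (ff (r a)).1 => b [/= -> p]; split=> // f0.
  by apply: p; rewrite f0 mul0r.
- apply: sub_finite_set (fg (r a)).1 => b [/= -> p]; split=> // f0.
  by apply: p; rewrite f0 mul0r.
Qed.

Lemma convolution_linearr (z : C) f g h : fibre_finite h ->
  convolution h (fun a => z * f a + g a) =
  (fun a => z * convolution h f a + convolution h g a).
Proof.
move=> fh; apply/funext => a; rewrite /convolution -fsum_linear.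
- by apply: eq_fsbigr => b _; rewrite mulrDr mulrCA.
- apply: sub_finite_set (fh (r a)).1 => b [/= -> p]; split=> // f0.
  by apply: p; rewrite f0 mul0r.
- apply: sub_finite_set (fh (r a)).1 => b [/= -> p]; split=> // f0.
  by apply: p; rewrite f0 mul0r.
Qed.

Lemma convolution0l f : convolution (fun=> 0) f = (fun=> 0).
Proof.
by apply/funext => a; rewrite /convolution fsbig1// => b _; rewrite mul0r.
Qed.

Lemma convolution0r f : convolution f (fun=> 0) = (fun=> 0).
Proof.
by apply/funext => a; rewrite /convolution fsbig1// => b _; rewrite mulr0.
Qed.

Lemma convolution_bisection U f g a b : bisection U ->
  (forall c, ~ U c -> f c = 0) -> U b -> r b = r a ->
  convolution f g a = f b * g (gmul (ginv b) a).
Proof.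
move=> [_ ri _] f0 Ub ba; apply: fsum_single => // c /= ca cb.
have [Uc|/f0 ->] := pselect (U c); last by rewrite mul0r.
by case: cb; apply: ri; rewrite ?inE// ca ba.
Qed.

Lemma convolution_out U f g a : (forall c, ~ U c -> f c = 0) ->
  ~ (r @` U) (r a) -> convolution f g a = 0.
Proof.
move=> f0 Ua; apply: fsbig1 => b /= ba; rewrite f0 ?mul0r// => Ub.
by apply: Ua; exists b.
Qed.

Context (hX : hausdorff_space X).

(** On products of arrows from two bisections, the convolution is the product of
    the values at the two factors, which depend continuously on the arrow. *)
Lemma Cc_convolution U V f g : bisection U -> bisection V ->
  Cc U f -> Cc V g -> Cc (bisection_mul U V) (convolution f g).
Proof.
move=> bU bV fU gV; have [q [qU qE qc cc]] := bisection_division bU.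
have f0 c : ~ U c -> f c = 0 by exact: (Cc_eq0 fU).
have cE a : (r @` U) (r a) -> convolution f g a = f (q a) * g (gmul (ginv (q a)) a).
  by move=> /qU[Uq rq]; apply: convolution_bisection bU f0 Uq rq.
split.
- move=> _ [b [c [Ub Vc bc ->]]].
  have ra : (r @` U) (r (gmul b c)) by exists b => //; rewrite grng_mul.
  have near_ra : \forall a \near gmul b c, (r @` U) (r a).
    apply: grng_continuous; apply: open_nbhs_nbhs; split=> //.
    by apply: grng_open; case: bU.
  have qb : q (gmul b c) = b by apply: qE; rewrite ?grng_mul.
  have : {for gmul b c, continuous (fun a => f (q a) * g (gmul (ginv (q a)) a))}.
    apply: (@continuousM _ _ (f \o q) (g \o (fun a => gmul (ginv (q a)) a))).
      apply: continuous_comp; first exact: qc.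
      by rewrite qb; case: fU => + _; apply.
    apply: continuous_comp; first exact: cc.
    by rewrite qb gmulKV//; case: gV => + _; apply.
  rewrite /prop_for /continuous_at /= -cE// => h; apply: cvg_trans h.
  apply: near_eq_cvg; apply: filterS near_ra => a /cE ->; done.
- case: fU => _ [K [cK KU] K0]; case: gV => _ [L [cL LV] L0].
  exists (bisection_mul K L).
    split; first exact: compact_mul.
    move=> _ [b [c [Kb Lc bc ->]]]; exists b, c; split=> //; [exact: KU|exact: LV].
  move=> a nKL; have [ra|] := pselect ((r @` U) (r a)); last exact: convolution_out.
  rewrite cE//; have [Uq rq] := qU _ ra.
  have [Kq|/K0 ->] := pselect (K (q a)); last by rewrite mul0r.
  have [Lq|/L0 ->] := pselect (L (gmul (ginv (q a)) a)); last by rewrite mulr0.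
  case: nKL; exists (q a), (gmul (ginv (q a)) a); split=> //.
    by rewrite grng_mul ?gsrc_inv// grng_inv.
  by rewrite gmulVK.
Qed.

Lemma quasi_continuous_convolution f g : quasi_continuous f ->
  quasi_continuous g -> quasi_continuous (convolution f g).
Proof.
move=> qf qg; elim/quasi_continuous_ind: qf => [|U {}f bU fU|z f1 f2 q1 q2 I1 I2].
- by rewrite convolution0l; exact: quasi_continuous0.
- elim/quasi_continuous_ind: qg => [|V {}g bV gV|z g1 g2 q1 q2 I1 I2].
  + by rewrite convolution0r; exact: quasi_continuous0.
  + apply: quasi_continuous_Cc (bisection_mulP bU bV) _; exact: Cc_convolution.
  + rewrite convolution_linearr; first exact: quasi_continuous_linear.
    exact/quasi_continuous_fibre_finite/(quasi_continuous_Cc bU).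
- rewrite convolution_linearl; first exact: quasi_continuous_linear.
  + exact: quasi_continuous_fibre_finite.
  + exact: quasi_continuous_fibre_finite.
Qed.

End GroupoidFunctions.

(** * Functions on the unit space *)

Section BumpFunctions.
Context {R : realType} {X : topologicalType}.
Context (hX : hausdorff_space X) (lX : locally_compact [set: X]).

(** Complete regularity gives a function vanishing off an open set; shrinking
    that open set by regularity puts a compact set between it and [V]. *)
Lemma exists_bump (V : set X) x : open V -> V x ->
  exists2 u : X -> R, continuous u /\ (forall y, 0 <= u y <= 1) /\ u x = 1 &
    exists2 K, compact K /\ K `<=` V & forall y, ~ K y -> u y = 0.
Proof.
move=> oV Vx.
have [U nU' [cU clU]] := @lX x I.
have nU : nbhs x U.
  by apply: (@filterS _ (nbhs x) _ [set y | [set: X] y -> U y]) => // y; apply.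
have pU : precompact U by rewrite precompact_closed.
have cr := locally_compact_completely_regular (R := R) lX hX.
have nV : nbhs x V by exact: open_nbhs_nbhs.
have [W nW WV] : filter_from (nbhs x) closure V.
  exact: (completely_regular_regular cr nV).
pose K := closure (U `&` W).
have nB : ~ (~` (U `&` W)°) x by apply; exact: (filterI nU nW).
have clB : closed (~` (U `&` W)°) by apply: open_closedC; exact: open_interior.
have /(@uniform_separatorP _ R) [f [fc f01 fx fB]] := cr x _ clB nB.
exists (fun y => 1 - f y); last exists K.
- split; first by move=> y; apply: continuousB; [exact: cvg_cst | exact: fc].
  split=> [y|]; last first.
    by rewrite (_ : f x = 0) ?subr0//; apply: fx; exists x.
  have /(_ (f y)) := f01; rewrite /= in_itv /= => /(_ _)/andP[]; first by exists y.
  by move=> ? ?; apply/andP; split; lra.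
- split; first by rewrite -precompactE; apply: precompact_subset pU; exact: subIsetl.
  by apply: subset_trans WV; apply: closureS; exact: subIsetr.
- move=> y Ky; rewrite (_ : f y = 1) ?subrr//; apply: fB; exists y => //.
  by move=> /interior_subset /subset_closure.
Qed.

End BumpFunctions.

Section UnitSpaceFunctions.
Context {R : realType} {X : topologicalType}.
Local Notation C := (Cplx R).
Implicit Types (g h : X -> C).

Definition Cc_space g := continuous g /\
  exists2 K, compact K & forall x, ~ K x -> g x = 0.

Lemma continuous_at_conj (T : topologicalType) (f : T -> C) x :
  {for x, continuous f} -> {for x, continuous (fun t => (f t)^*)}.
Proof.
move=> fc; apply/cvgrPdist_lt => e e0 /=.
move/cvgrPdist_lt: fc => /(_ _ e0).
by apply: filterS => t; rewrite -rmorphB norm_conjC.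
Qed.

Lemma continuous_ofR (T : topologicalType) (f : T -> R) :
  continuous f -> continuous (ofR \o f).
Proof. by move=> fc x; apply: continuous_at_ofR; exact: fc. Qed.

Lemma Cc_space_sub g h : Cc_space g -> continuous h ->
  (forall x, g x = 0 -> h x = 0) -> Cc_space h.
Proof.
by move=> [gc [K cK K0]] hc gh; split=> //; exists K => // x /K0 /gh.
Qed.

Lemma Cc_space_linear (z : C) g h : Cc_space g -> Cc_space h ->
  Cc_space (fun x => z * g x + h x).
Proof.
move=> [gc [K cK K0]] [hc [L cL L0]]; split.
  move=> x; apply: (@continuousD _ _ _ (fun x => z * g x) h); last exact: hc.
  by apply: continuousM; [exact: cvg_cst | exact: gc].
exists (K `|` L); first exact: compactU.
by move=> x KL; rewrite K0 ?L0 ?mulr0 ?addr0// => ?; apply: KL; [right|left].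
Qed.

Lemma Cc_space_mul g h : Cc_space g -> continuous h ->
  Cc_space (fun x => g x * h x).
Proof.
move=> cg hc; apply: (Cc_space_sub cg) => [|x ->]; last by rewrite mul0r.
by move=> x; apply: continuousM; [case: cg => + _; apply | exact: hc].
Qed.

Lemma Cc_space_conj g : Cc_space g -> Cc_space (fun x => (g x)^*).
Proof.
move=> cg; apply: (Cc_space_sub cg) => [x|x ->]; last by rewrite rmorph0.
by apply: continuous_at_conj; case: cg => + _; apply.
Qed.

Lemma Cc_space0 : Cc_space (fun=> 0).
Proof. by split; [move=> x; exact: cvg_cst | exists set0 => //; exact: compact0]. Qed.

Lemma Cc_spaceZ (z : C) g : Cc_space g -> Cc_space (fun x => z * g x).
Proof.
move=> cg; apply: (Cc_space_sub cg) => [x|x ->]; last by rewrite mulr0.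
by apply: continuousM; [exact: cvg_cst | case: cg => + _; apply].
Qed.

(** A compact set is closed in the Hausdorff space [X], so the two regions where
    continuity is known or trivial form an open cover. *)
Lemma Cc_space_extend (V K : set X) g : hausdorff_space X -> compact K ->
  K `<=` V -> (forall x, V x -> {for x, continuous g}) ->
  (forall x, ~ K x -> g x = 0) -> Cc_space g.
Proof.
move=> hX cK KV gc g0; split; last by exists K.
move=> x; have [Kx|nKx] := pselect (K x); first exact/gc/KV.
have n0 : \forall y \near x, g y = 0.
  have : nbhs x (~` K).
    by apply: open_nbhs_nbhs; split => //; apply: closed_openC; exact: compact_closed.
  by apply: filterS => y; exact: g0.
rewrite /continuous_at (nbhs_singleton n0).
by apply: cvg_near_cst; exact: n0.
Qed.

Lemma Cc_space_C0 g : Cc_space g -> C0 g.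
Proof.
move=> [gc [K cK K0]]; split=> // e e0; exists K => // x /K0 ->.
by rewrite normr0.
Qed.

End UnitSpaceFunctions.

Section UnitExtension.
Context {R : realType} {X : topologicalType} {H : etaleGroupoid X}.
Local Notation C := (Cplx R).
Local Notation s := (@gsrc X H).
Local Notation r := (@grng X H).
Local Notation unit := (@gunit X H).
Implicit Types (g h : X -> C) (f : H -> C).

Definition unit_ext g : H -> C := fun a => if a \in @unit_arrows X H then g (s a) else 0.

Lemma unit_ext_unit g x : unit_ext g (unit x) = g x.
Proof. by rewrite /unit_ext mem_set ?gsrc_unit//; exists x. Qed.

Lemma unit_ext_out g a : ~ unit_arrows a -> unit_ext g a = 0.
Proof. by move=> ua; rewrite /unit_ext memNset. Qed.

Lemma unit_ext_linear z g h :
  unit_ext (fun x => z * g x + h x) = (fun a => z * unit_ext g a + unit_ext h a).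
Proof.
by apply/funext => a; rewrite /unit_ext; case: ifP => // _; rewrite mulr0 addr0.
Qed.

Lemma Cc_unit_ext g : Cc_space g -> Cc (@unit_arrows X H) (unit_ext g).
Proof.
move=> [gc [K cK K0]]; split.
- move=> a ua; have e : unit_ext g a = g (s a) by rewrite /unit_ext mem_set.
  have : {for a, continuous (g \o s)}.
    by apply: continuous_comp; [exact: gsrc_continuous | exact: gc].
  rewrite /prop_for /continuous_at /= -e => h; apply: cvg_trans h.
  apply: near_eq_cvg.
  have : nbhs a (@unit_arrows X H).
    by apply: open_nbhs_nbhs; split => //; exact: unit_arrows_open.
  by apply: filterS => b ub; rewrite /unit_ext mem_set.
- exists (unit @` K); first split.
  + apply: continuous_compact => //.
    by apply: continuous_subspaceT; exact: gunit_continuous.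
  + by move=> _ [x _ <-]; exists x.
  + move=> a Ka; have [[x _ xa]|/unit_ext_out ->//] := pselect (unit_arrows a).
    rewrite -xa unit_ext_unit K0// => Kx.
    by apply: Ka; exists x.
Qed.

(** Makes [C0_image], which speaks of functions on the groupoid, accessible to
    functions on the unit space. *)
Lemma Cc_unit_restrict f : Cc (@unit_arrows X H) f ->
  Cc_space (f \o unit) /\ f = unit_ext (f \o unit).
Proof.
move=> fc; have f0 a := @Cc_eq0 _ _ _ _ _ a fc; split; last first.
  apply/funext => a; have [[x _ <-]|ua] := pselect (unit_arrows a).
    by rewrite unit_ext_unit.
  by rewrite unit_ext_out// f0.
case: fc => fc [K [cK KU] K0]; split.
  move=> x; apply: continuous_comp; first exact: gunit_continuous.
  by apply: fc; exists x.
exists (s @` K).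
  apply: continuous_compact => //.
  by apply: continuous_subspaceT; exact: gsrc_continuous.
move=> x Kx /=; apply: K0 => Ku; apply: Kx; exists (unit x) => //.
exact: gsrc_unit.
Qed.

Lemma quasi_continuous_unit_ext g : Cc_space g -> quasi_continuous (unit_ext g).
Proof.
by move=> /Cc_unit_ext; exact: quasi_continuous_Cc (@unit_arrows_bisection X H).
Qed.

Lemma convolution_unitl g f :
  convolution (unit_ext g) f = (fun a => g (r a) * f a).
Proof.
apply/funext => a.
rewrite (@convolution_bisection _ _ _ _ _ _ _ (unit (r a)) (@unit_arrows_bisection X H)).
- by rewrite unit_ext_unit ginv_unit gmul1l.
- exact: unit_ext_out.
- by exists (r a).
- by rewrite grng_unit.
Qed.

Lemma convolution_unitr g f :
  convolution f (unit_ext g) = (fun a => f a * g (s a)).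
Proof.
apply/funext => a; rewrite /convolution (@fsum_single _ _ _ a)//.
  by rewrite gmulVl unit_ext_unit.
move=> b /= ba nba; rewrite unit_ext_out ?mulr0// => -[x _ xe]; apply: nba.
have e : s (ginv b) = r a by rewrite gsrc_inv.
have : r (gmul (ginv b) a) = r (ginv b) by apply: grng_mul.
rewrite -xe grng_unit grng_inv => xb.
by rewrite -(gmulVK ba) -xe xb gmul1.
Qed.

Lemma convolution_unit g h :
  convolution (unit_ext g) (unit_ext h) = unit_ext (fun x => g x * h x).
Proof.
rewrite convolution_unitl; apply/funext => a.
have [[x _ <-]|ua] := pselect (unit_arrows a).
  by rewrite !unit_ext_unit grng_unit.
by rewrite !unit_ext_out// mulr0.
Qed.

Lemma invol_unit g : invol (unit_ext g) = unit_ext (fun x => (g x)^*).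
Proof.
apply/funext => a; rewrite /invol.
have [[x _ <-]|ua] := pselect (unit_arrows a).
  by rewrite ginv_unit !unit_ext_unit.
rewrite !unit_ext_out ?rmorph0// => -[x _ xa]; apply: ua.
by rewrite -(ginvK a) -xa ginv_unit; exists x.
Qed.

End UnitExtension.

(** * Norm estimates in the completion *)

Section CstarBasics.
Context {R : realType} {B : cstarAlgebra R}.
Local Notation C := (Cplx R).
Implicit Types (a b c : B).

Lemma cmul0l c : cmul (0 : B) c = 0.
Proof.
by have := cmul_linearl (-1) 0 0 c; rewrite scaler0 addr0 => {1}->; rewrite scaleN1r addNr.
Qed.
Lemma cmul0r c : cmul c (0 : B) = 0.
Proof.
by have := cmul_linearr (-1) 0 0 c; rewrite scaler0 addr0 => {1}->; rewrite scaleN1r addNr.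
Qed.
Lemma cmulBl a b c : cmul (a - b) c = cmul a c - cmul b c.
Proof.
by have := cmul_linearl (-1) b a c; rewrite !scaleN1r addrC => ->; rewrite addrC.
Qed.
Lemma cmulBr a b c : cmul c (a - b) = cmul c a - cmul c b.
Proof.
by have := cmul_linearr (-1) b a c; rewrite !scaleN1r addrC => ->; rewrite addrC.
Qed.

Lemma cstar_norm a : `|cstar a| = `|a|.
Proof.
have le b : `|b| <= `|cstar b|.
  have [->|b0] := eqVneq b 0; first by rewrite normr0.
  have := cmul_norm (cstar b) b; rewrite cstar_identity expr2.
  by rewrite ler_pM2r// normr_gt0.
by apply/eqP; rewrite eq_le le andbT -{2}(cstarK a) le.
Qed.

Section Ideal.
Context {J : set B} (idJ : closed_ideal J).

Lemma idealZ (z : C) a : J a -> J (z *: a).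
Proof. by move=> Ja; rewrite -[_ *: _]addr0; apply: (ideal_linear idJ) => //; exact: (ideal0 idJ). Qed.
Lemma idealD a b : J a -> J b -> J (a + b).
Proof. by move=> Ja Jb; rewrite -[a]scale1r; exact: ideal_linear. Qed.
Lemma idealB a b : J a -> J b -> J (a - b).
Proof. by move=> Ja Jb; rewrite -scaleN1r; apply: idealD => //; exact: idealZ. Qed.

End Ideal.

Lemma closure_approx (S : set B) b :
  closure S b <-> forall e : R, 0 < e -> exists2 c, S c & `|b - c| < ofR e.
Proof.
split=> [clb e e0|ap].
  have [c [/= Sc bc]] : S `&` ball b (ofR e) !=set0.
    by apply: clb; apply: nbhsx_ballx; rewrite -ofR0 ofR_lt.
  by exists c => //; move: bc; rewrite -ball_normE.
move=> A /nbhs_ballP [e /= e0 eA].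
have eE : e = ofR (reC e) by rewrite reCK// gtr0_real.
have [|c Sc bc] := ap (reC e); first by rewrite -ofR_lt -eE.
by exists c; split => //; apply: eA; rewrite -ball_normE /= eE.
Qed.

Lemma norm_le_eps (V : normedModType C) (a : V) :
  (forall e : R, 0 < e -> `|a| <= ofR e) -> a = 0.
Proof.
move=> h; apply/eqP; rewrite -normr_le0.
have E : `|a| = ofR (reC `|a|) by rewrite reCK// normr_real.
rewrite E -ofR0 ofR_le; apply/ler_addgt0Pl => e e0.
by rewrite addr0 -ofR_le -E; exact: h.
Qed.

End CstarBasics.

Section CompletionNorm.
Context {R : realType} {X : topologicalType} {H : etaleGroupoid X}.
Context {B : cstarAlgebra R} {iota : (H -> Cplx R) -> B}.
Context (B_max : is_max_completion iota).
Local Notation C := (Cplx R).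
Implicit Types (g h : X -> C) (f : H -> C).

Let hom := completion_hom B_max.

Lemma iota_linear (z : C) f1 f2 : quasi_continuous f1 -> quasi_continuous f2 ->
  iota (fun a => z * f1 a + f2 a) = z *: iota f1 + iota f2.
Proof. by move=> q1 q2; rewrite (hom_linear hom). Qed.

Lemma iota0 : iota (fun=> 0) = 0.
Proof.
have := iota_linear (-1) (@quasi_continuous0 R X H) (@quasi_continuous0 R X H).
rewrite scaleN1r addNr => <-; congr iota; apply/funext => a.
by rewrite mulr0 addr0.
Qed.

Lemma iotaB f1 f2 : quasi_continuous f1 -> quasi_continuous f2 ->
  iota (fun a => f1 a - f2 a) = iota f1 - iota f2.
Proof.
move=> q1 q2; rewrite -scaleN1r addrC -iota_linear//; congr iota.
by apply/funext => a; rewrite mulN1r addrC.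
Qed.

(** The inclusion of C_c(X) in the completion. *)
Definition embed g : B := iota (unit_ext g).
Local Notation io := embed.

Lemma embed_linear (z : C) g h : Cc_space g -> Cc_space h ->
  io (fun x => z * g x + h x) = z *: io g + io h.
Proof.
move=> cg ch; rewrite /embed unit_ext_linear iota_linear//;
  exact: quasi_continuous_unit_ext.
Qed.

Lemma embedM g h : Cc_space g -> Cc_space h ->
  io (fun x => g x * h x) = cmul (io g) (io h).
Proof.
move=> cg ch; rewrite /embed -convolution_unit (hom_mul hom)//;
  exact: quasi_continuous_unit_ext.
Qed.

Lemma embed_conj g : Cc_space g -> io (fun x => (g x)^*) = cstar (io g).
Proof.
move=> cg; rewrite /embed -invol_unit (hom_star hom)//;
  exact: quasi_continuous_unit_ext.
Qed.

Lemma embed0 : io (fun=> 0) = 0.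
Proof.
rewrite /embed -iota0; congr iota; apply/funext => a.
by rewrite /unit_ext; case: ifP.
Qed.

Lemma embedZ (z : C) g : Cc_space g -> io (fun x => z * g x) = z *: io g.
Proof.
move=> cg; have := embed_linear z cg (@Cc_space0 R X); rewrite embed0 addr0 => <-.
by congr io; apply/funext => x; rewrite addr0.
Qed.

(** As [1 + w] is unitary, [w^* w = - w - w^*]; the C*-identity then gives
    [|w|^2 <= 2 |w|]. This absolute bound is the only source of boundedness for
    the map from functions to the completion. *)
Lemma embed_unitary_bound w : Cc_space w ->
  (forall x, w x + (w x)^* + (w x)^* * w x = 0) -> `|io w| <= 2.
Proof.
move=> cw w1; have cw' := Cc_space_conj cw.
have [->|w0] := eqVneq (io w) 0; first by rewrite normr0.
have e : cmul (cstar (io w)) (io w) = - io w - cstar (io w).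
  rewrite -embed_conj// -embedM// -[- io w]scaleN1r -[- io _]scaleN1r.
  rewrite -(embedZ (-1) cw') -embed_linear//; last first.
    exact: Cc_spaceZ.
  congr io; apply/funext => x; have := w1 x => /eqP; rewrite addr_eq0 => /eqP h.
  by rewrite !mulN1r -[RHS]opprK opprD !opprK h opprK.
have := cstar_identity (io w); rewrite e => h.
have : `|io w| ^+ 2 <= 2 * `|io w|.
  rewrite -h -opprD normrN (le_trans (ler_normD _ _))// cstar_norm.
  by rewrite mulr_natl.
by rewrite expr2 ler_pM2r// normr_gt0.
Qed.

(** A real function between -1 and 1 is the imaginary part of a unimodular one,
    namely [sqrt (1 - u^2) + i u]. *)
Lemma embed_real_bound (u : X -> R) : Cc_space (ofR \o u) -> continuous u ->
  (forall x, `|u x| <= 1) -> `|io (ofR \o u)| <= 2.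
Proof.
move=> cu uc u1.
pose v x := Num.sqrt (1 - u x ^+ 2) - 1.
pose w x : C := ofR (v x) + 'i * ofR (u x).
have u2 x : 0 <= 1 - u x ^+ 2 by rewrite subr_ge0 -real_normK ?num_real// expr_le1.
have vc : continuous v.
  move=> x; apply: (@continuousB _ _ _ (fun x => Num.sqrt (1 - u x ^+ 2)) (fun=> 1)); last exact: cvg_cst.
  apply: (@continuous_comp _ _ _ (fun x => 1 - u x ^+ 2) Num.sqrt).
    apply: continuousB; first exact: cvg_cst.
    by apply: continuousM; exact: uc.
  exact: sqrt_continuous.
have cw : Cc_space w.
  apply: (Cc_space_sub cu) => [x|x /= ux0].
    apply: (@continuousD _ _ _ (ofR \o v) (fun x => 'i * ofR (u x))).
      by apply: continuous_at_ofR; exact: vc.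
    apply: continuousM; first exact: cvg_cst.
    by apply: continuous_at_ofR; exact: uc.
  have {}ux0 : u x = 0 by rewrite -[u x]ofRK ux0.
  by rewrite /w /v ux0 expr0n subr0 sqrtr1 subrr ofR0 mulr0 addr0.
have wJ x : (w x)^* = ofR (v x) - 'i * ofR (u x).
  by rewrite /w rmorphD rmorphM /= !ofR_conj conjCi mulNr.
have w1 : `|io w| <= 2.
  apply: embed_unitary_bound => // x; rewrite wJ /w.
  have -> : forall a b i : C, a + i * b + (a - i * b) + (a - i * b) * (a + i * b) =
     (a + 1) ^+ 2 - i ^+ 2 * b ^+ 2 - 1 by move=> *; ring.
  rewrite sqrCi mulN1r opprK -ofR1 -ofRD -!ofRX -ofRD -ofRB.
  by rewrite /v subrK sqr_sqrtr// subrK subrr.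
have -> : io (ofR \o u) = (2 * 'i)^-1 *: (io w - cstar (io w)).
  rewrite -embed_conj// -[X in _ + X]scaleN1r addrC -embed_linear//; last exact: Cc_space_conj.
  rewrite -embedZ; last by apply: Cc_space_linear => //; exact: Cc_space_conj.
  congr io; apply/funext => x; rewrite wJ /w /=.
  have i0 : 'i != 0 :> C by exact: neq0Ci.
  have -> : forall a b i : C, -1 * (a - i * b) + (a + i * b) = 2 * i * b by move=> *; ring.
  by rewrite mulKf// mulf_neq0// pnatr_eq0.
rewrite normrZ normfV normrM normCi mulr1 normr_nat.
rewrite ler_pdivrMl ?ltr0n// (le_trans (ler_normB _ _))// cstar_norm.
by rewrite mulr_natl mulr2n lerD.
Qed.

(** The real case applies to [|g|^2], and the C*-identity goes back to [g]. *)
Lemma embed_norm g (m : R) : 0 <= m -> Cc_space g ->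
  (forall x, `|g x| <= ofR m) -> `|io g| <= 2 * ofR m.
Proof.
move=> m0 cg gm; have [mz|mn0] := eqVneq m 0.
  rewrite (_ : g = fun=> 0) ?embed0 ?normr0 ?mz ?ofR0 ?mulr0//.
  apply/funext => x; apply/eqP; rewrite -normr_le0; have := gm x.
  by rewrite mz ofR0.
have mp : 0 < m by rewrite lt_neqAle eq_sym mn0.
pose u x : R := reC (`|g x| ^+ 2) / m ^+ 2.
have uE x : (g x)^* * g x = ofR (m ^+ 2) * ofR (u x).
  by rewrite mulrC -normCK -ofRM /u mulrC divfK ?expf_neq0// reCK.
have uc : continuous u.
  move=> x; apply: (@continuousM _ _ (fun x => reC (`|g x| ^+ 2)) (fun=> (m ^+ 2)^-1)); last exact: cvg_cst.
  apply: (continuous_at_reC (f := fun x => `|g x| ^+ 2)).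
  by apply: continuousM; apply: cvg_norm; case: cg => + _; apply.
have cu : Cc_space (ofR \o u).
  apply: (Cc_space_sub cg) => [|x /= gx]; first exact: continuous_ofR.
  by rewrite /u gx normr0 expr0n mul0r.
have u1 x : `|u x| <= 1.
  have gE : `|g x| = ofR (reC `|g x|) by rewrite reCK// normr_real.
  rewrite /u gE -ofRX ofRK -expr_div_n ger0_norm ?sqr_ge0//.
  rewrite -[leRHS](expr1n _ 2) ler_pXn2r ?nnegrE ?ler01//.
    by rewrite ler_pdivrMr// mul1r -ofR_le -gE.
  by rewrite divr_ge0// -ofR_le -gE ofR0.
have sq : `|io g| ^+ 2 <= (2 * ofR m) ^+ 2.
  rewrite -cstar_identity -embed_conj// -embedM//; last exact: Cc_space_conj.
  rewrite (_ : (fun x => _) = (fun x => ofR (m ^+ 2) * (ofR \o u) x)); last first.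
    by apply/funext => x; exact: uE.
  rewrite embedZ// normrZ ger0_norm -?ofR0 ?ofR_le ?sqr_ge0//.
  apply: (@le_trans _ _ (ofR (m ^+ 2) * 2)).
    by rewrite ler_pM2l -?ofR0 ?ofR_lt ?exprn_gt0//; exact: embed_real_bound.
  rewrite exprMn mulrC -ofRX ler_pM2r -?ofR0 ?ofR_lt ?exprn_gt0//.
  by rewrite -natrX ler_nat.
by move: sq; rewrite ler_pXn2r ?nnegrE// mulr_ge0// -ofR0 ofR_le.
Qed.

Lemma quasi_continuous_dense b (e : R) : 0 < e ->
  exists2 f, quasi_continuous f & `|b - iota f| < ofR e.
Proof.
move=> e0; have := completion_dense B_max.
have bO : (ball b (ofR e))° b.
  by apply: nbhsx_ballx; rewrite -ofR0 ofR_lt.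
move=> /(_ _ (ex_intro _ b bO) (@open_interior _ _)) [c [/interior_subset + [f qf fc]]].
by rewrite -ball_normE -fc => ?; exists f.
Qed.

End CompletionNorm.

Arguments embed {R X H B} iota g.

(** * Trivially meeting ideals and EL *)

Section IdealClosure.
Context {R : realType} {B : cstarAlgebra R}.
Local Notation C := (Cplx R).

(** The multiplicative hypotheses ask for membership in the closure only, so
    that multipliers can be taken from a dense subset first. *)
Lemma closure_ideal (S : set B) : S 0 ->
  (forall (z : C) a b, S a -> S b -> S (z *: a + b)) ->
  (forall a b, S b -> closure S (cmul a b)) ->
  (forall a b, S a -> closure S (cmul a b)) ->
  closed_ideal (closure S).
Proof.
move=> S0 Sl Sml Smr.
have cc b : (forall e : R, 0 < e -> exists2 c, closure S c & `|b - c| < ofR e) -> closure S b.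
  by move=> /closure_approx; rewrite -(iffLR (closure_id _) (@closed_closure _ S)).
split.
- exact: closed_closure.
- exact: subset_closure.
- move=> z a b /closure_approx ha /closure_approx hb; apply/closure_approx => e e0.
  have e2 : 0 < e / 2 by lra.
  have z1 : 0 < reC `|z| + 1 by rewrite ltr_wpDl// reC_norm_ge0.
  have [a' Sa aa] := ha (e / 2 / (reC `|z| + 1)) (divr_gt0 e2 z1).
  have [b' Sb bb] := hb _ e2.
  exists (z *: a' + b'); first exact: Sl.
  rewrite opprD addrACA -scalerBr (splitr e) ofRD.
  rewrite (le_lt_trans (ler_normD _ _))// ler_ltD// normrZ.
  apply: le_trans (ler_wpM2l (normr_ge0 z) (ltW aa)) _.
  rewrite {1}normr_ofR -ofRM ofR_le mulrC mulrAC ler_pdivrMr// ler_pM2l// lerDl//.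
- move=> a b /closure_approx hb; apply: cc => e e0.
  have a1 : 0 < reC `|a| + 1 by rewrite ltr_wpDl// reC_norm_ge0.
  have [b' Sb bb] := hb (e / (reC `|a| + 1)) (divr_gt0 e0 a1).
  exists (cmul a b'); first exact: Sml.
  rewrite -cmulBr (le_lt_trans (cmul_norm _ _))//.
  rewrite (normr_ofR a) (normr_ofR (b - b')) -ofRM ofR_lt.
  rewrite (normr_ofR (b - b')) ofR_lt ltr_pdivlMr// in bb.
  apply: le_lt_trans bb; by rewrite mulrC ler_wpM2l ?reC_norm_ge0// lerDl.
- move=> b a /closure_approx hb; apply: cc => e e0.
  have a1 : 0 < reC `|a| + 1 by rewrite ltr_wpDl// reC_norm_ge0.
  have [b' Sb bb] := hb (e / (reC `|a| + 1)) (divr_gt0 e0 a1).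
  exists (cmul b' a); first exact: Smr.
  rewrite -cmulBl (le_lt_trans (cmul_norm _ _))//.
  rewrite (normr_ofR a) (normr_ofR (b - b')) -ofRM ofR_lt.
  rewrite (normr_ofR (b - b')) ofR_lt ltr_pdivlMr// in bb.
  apply: le_lt_trans bb; by rewrite ler_wpM2l ?reC_norm_ge0// lerDl.
Qed.

End IdealClosure.

Lemma continuous_at_expr (R : realType) (T : topologicalType) (f : T -> Cplx R) x n :
  {for x, continuous f} -> {for x, continuous (fun y => f y ^+ n)}.
Proof.
move=> fc; elim: n => [|n IHn]; rewrite /prop_for /continuous_at.
  by rewrite expr0; under eq_fun do rewrite expr0; exact: cvg_cst.
rewrite exprS (funext (fun y => exprS (f y) n)).
exact: (@continuousM _ _ f (fun y => f y ^+ n) x fc IHn).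
Qed.

Section LocalMultipliers.
Context {R : realType} {X : topologicalType} {H : etaleGroupoid X}.
Context (hX : hausdorff_space X) (lX : locally_compact [set: X]).
Context {B : cstarAlgebra R} {iota : (H -> Cplx R) -> B}.
Context (B_max : is_max_completion iota).
Context {M : cstarAlgebra R} {j : set X -> (X -> Cplx R) -> M}.
Context (M_loc : is_local_multiplier_algebra j).
Context {EL : B -> M} (EL_can : is_EL iota j EL).
Local Notation C := (Cplx R).
Local Notation unit := (@gunit X H).
Local Notation A := (C0_image iota).
Local Notation io := (embed iota).
Implicit Types (g h : X -> C) (f : H -> C).

Lemma dense_openI (V W : set X) : dense_open V -> dense_open W ->
  dense_open (V `&` W).
Proof.
move=> [oV dV] [oW dW]; split; first exact: openI.
by move=> O O0 oO; rewrite setIA; apply: dW; [exact: dV | exact: openI].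
Qed.

Lemma dense_open_setUC (V : set X) : open V -> dense_open (V `|` ~` closure V).
Proof.
move=> oV; split; first by apply: openU => //; apply: closed_openC; exact: closed_closure.
move=> O [x Ox] oO; have [clx|nclx] := pselect (closure V x).
  have [y [Vy Oy]] := clx O (open_nbhs_nbhs (conj oO Ox)).
  by exists y; split => //; left.
by exists x; split => //; right.
Qed.

Lemma CbS (V W : set X) g : W `<=` V -> Cb V g -> Cb W g.
Proof.
move=> WV [gc [m gm]]; split; first by move=> x /WV; exact: gc.
by exists m => x /WV; exact: gm.
Qed.

(** As [f] vanishes off [U], the two-case formula that defines [EL] is the
    restriction of [f] to the units. *)
Lemma EL_Cc_unit (U : set H) f : bisection U -> Cc U f ->
  let V := unit @^-1` U `|` ~` closure (unit @^-1` U) in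
  [/\ dense_open V, Cb V (f \o unit) & EL (iota f) = j V (f \o unit)].
Proof.
move=> bU fU V; pose UX := unit @^-1` U.
have oUX : open UX.
  by apply: open_comp; [move=> x _; exact: gunit_continuous | case: bU].
split; first exact: dense_open_setUC.
- split; last by have [m _ mP] := Cc_bounded fU; exists (ofR m) => x _; exact: mP.
  move=> x [Ux|nUx].
    apply: continuous_comp; first exact: gunit_continuous.
    by case: fU => + _; apply.
  have n0 : \forall y \near x, (f \o unit) y = 0.
    have : nbhs x (~` closure UX).
      apply: open_nbhs_nbhs; split=> //; apply: closed_openC; exact: closed_closure.
    apply: filterS => y nUy /=; apply: (Cc_eq0 fU) => Uy.
    by apply: nUy; exact: subset_closure.
  rewrite /prop_for /continuous_at (nbhs_singleton n0).
  by apply: cvg_near_cst; exact: n0.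
- have -> : f \o unit = (fun x => if x \in UX then f (unit x) else 0).
    apply/funext => x /=; case: ifPn => // /negP nx.
    by apply: (Cc_eq0 fU) => Ux; apply: nx; exact/mem_set.
  exact: (EL_Cc EL_can bU fU).
Qed.

(** The formula for [EL] extends from one bisection to linear combinations, on
    the intersection of the dense open sets involved. *)
Lemma EL_quasi_continuous f : quasi_continuous f ->
  exists V, [/\ dense_open V, Cb V (f \o unit) & EL (iota f) = j V (f \o unit)].
Proof.
elim/(@quasi_continuous_ind R X H) => [|U {}f bU fU|z f1 f2 q1 q2 [V [dV bV eV]] [W [dW bW eW]]].
- have c0 : Cc (@unit_arrows X H) (fun=> 0 : C).
    by split; [move=> a _; exact: cvg_cst | exists set0 => //; split=> //; exact: compact0].
  by have := EL_Cc_unit (@unit_arrows_bisection X H) c0; eexists; eassumption.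
- by have := EL_Cc_unit bU fU; eexists; eassumption.
- have dVW := dense_openI dV dW.
  have b1 : Cb (V `&` W) (f1 \o unit) by apply: CbS bV; exact: subIsetl.
  have b2 : Cb (V `&` W) (f2 \o unit) by apply: CbS bW; exact: subIsetr.
  exists (V `&` W); split=> //.
  + case: b1 => c1 [m1 m1P]; case: b2 => c2 [m2 m2P]; split.
      move=> x Vx; apply: (@continuousD _ _ _ (fun x => z * f1 (unit x)) (f2 \o unit)).
        by apply: continuousM; [exact: cvg_cst | exact: c1].
      exact: c2.
    exists (`|z| * m1 + m2) => x Vx; apply: le_trans (ler_normD _ _) _.
    by rewrite normrM lerD// ?m2P// ler_wpM2l// m1P.
  + rewrite iota_linear// (EL_linear EL_can) eV eW.
    rewrite (mloc_restrict M_loc (h := f1 \o unit) dV dVW)//.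
    rewrite (mloc_restrict M_loc (h := f2 \o unit) dW dVW)//.
    by rewrite -(hom_linear (mloc_hom M_loc dVW)).
Qed.

Lemma EL_large f (c : R) : 0 <= c -> quasi_continuous f ->
  ofR c < `|EL (iota f)| ->
  exists V, [/\ dense_open V, Cb V (f \o unit) &
    exists2 x, V x & ofR c < `|f (unit x)|].
Proof.
move=> c0 /EL_quasi_continuous [V [dV bV ->]] cE; exists V; split=> //.
apply: contrapT => nx; move: cE; apply/negP; rewrite -real_leNgt ?ofR_real ?normr_real//.
apply/(mloc_norm M_loc dV bV); first by rewrite -ofR0 ofR_le.
move=> x Vx; rewrite real_leNgt ?ofR_real ?normr_real//; apply/negP => cx.
by apply: nx; exists x.
Qed.

Lemma EL_embed_ge g x : Cc_space g -> `|g x| <= `|EL (io g)|.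
Proof.
move=> cg; have [dV bV ->] := EL_Cc_unit (@unit_arrows_bisection X H) (Cc_unit_ext cg).
have [+ _] := mloc_norm M_loc dV bV (normr_ge0 (j (unit @^-1` @unit_arrows X H `|`
  ~` closure (unit @^-1` @unit_arrows X H)) (unit_ext g \o unit))).
move=> /(_ (lexx _) x); rewrite /= unit_ext_unit; apply.
by left => /=; exists x.
Qed.

Lemma ELB a b : EL (a - b) = EL a - EL b.
Proof.
by rewrite addrC -scaleN1r (EL_linear EL_can) scaleN1r addrC.
Qed.

Lemma embed_ge g x : Cc_space g -> `|g x| <= `|io g|.
Proof.
by move=> cg; apply: le_trans (EL_embed_ge x cg) _; exact: EL_contractive EL_can _.
Qed.

Lemma embed_C0_image g : Cc_space g -> A (io g).
Proof.
move=> cg; exists g; first exact: Cc_space_C0.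
move=> e e0; exists (unit_ext g); split; first exact: Cc_unit_ext.
- by move=> x; rewrite unit_ext_unit subrr normr0 ltW.
- by rewrite subrr normr0 ltW.
Qed.

(** How an element of the copy of C_0(X) is shown to vanish: functions in C_c(X)
    near it have small sup norm, hence small norm by [embed_norm]. *)
Lemma C0_image_eq0 b (K : R) : 0 < K -> A b ->
  (forall (e : R) g, 0 < e -> Cc_space g -> `|b - io g| <= ofR e ->
     forall x, `|g x| <= ofR (K * e)) -> b = 0.
Proof.
move=> K0 [h _ happ] bg; apply: norm_le_eps => e e0.
have K1 : 0 < 1 + 2 * K by lra.
(* [io] at most doubles the bound [K * d], and [d + 2 * K * d = e]. *)
pose d := e / (1 + 2 * K); have d0 : 0 < d by exact: divr_gt0.
have [|f [cf _ bf]] := happ (ofR d); first by rewrite -ofR0 ofR_lt.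
have [cg fE] := Cc_unit_restrict cf; rewrite fE in bf.
have Kd : 0 <= K * d by rewrite mulr_ge0// ltW.
have := embed_norm B_max Kd cg (bg _ _ d0 cg bf) => gn.
rewrite -[b](subrK (io (f \o unit))).
apply: le_trans (ler_normD _ _) _; apply: le_trans (lerD bf gn) _.
rewrite -(ofR_nat 2).
rewrite -ofRM -ofRD ofR_le (_ : d + 2 * (K * d) = d * (1 + 2 * K)); last by ring.
by rewrite /d divfK// gt_eqF.
Qed.

Section TriviallyMeeting.
Context (J : set B) (tJ : trivially_meeting_ideal A J).

(** Powers of [io h - b] agree with powers of [io h] modulo [J]. A bump function
    [g] supported where [|h| > t], with [t] above the norm of [io h - b], is
    divisible by every [h ^+ n] with quotient bounded by [t ^- n], so that it is
    a limit of elements of [J]. *)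
Lemma trivially_meeting_dist h b x : Cc_space h -> J b ->
  `|h x| <= `|io h - b|.
Proof.
move=> ch Jb; have [idJ JA] := tJ.
rewrite real_leNgt ?normr_real//; apply/negP => bx.
pose d := reC `|io h - b|; pose t := (d + reC `|h x|) / 2.
have dE : `|io h - b| = ofR d by exact: normr_ofR.
have d0 : 0 <= d by exact: reC_norm_ge0.
have dt : d < t /\ t < reC `|h x|.
  by move: bx; rewrite dE (normr_ofR (h x)) ofR_lt /t => bx; split; lra.
have t0 : 0 < t by apply: le_lt_trans d0 dt.1.
pose O := (fun y => reC `|h y|) @^-1` [set y : R | t < y].
have oO : open O.
  apply: open_comp; last exact: open_gt.
  move=> y _; apply: (continuous_at_reC (f := fun y => `|h y|)).
  by apply: cvg_norm; case: ch => + _; apply.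
have [u [uc [u01 ux]] [K [cK KO] u0]] := exists_bump (R := R) hX lX oO dt.2.
pose g y := ofR (u y).
have gc : continuous g by exact: continuous_ofR.
have cg : Cc_space g by split=> //; exists K => // y /u0 uy; rewrite /g uy.
have hO y : O y -> h y != 0.
  by rewrite /O /= => ty; rewrite -normr_gt0 normr_ofR -ofR0 ofR_lt; exact: lt_trans ty.
pose k n y := g y / h y ^+ n.
have ck n : Cc_space (k n).
  apply: (Cc_space_extend hX cK KO) => [y Oy|y /u0 uy].
    apply: continuousM; first exact: gc.
    apply: continuousV; first by rewrite expf_neq0// hO.
    by apply: continuous_at_expr; case: ch => + _; apply.
  by rewrite /k /g uy mul0r.
have kh n : io (fun y => k n y * h y ^+ n) = io g.
  congr io; apply/funext => y; have [Oy|nOy] := pselect (O y).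
    by rewrite /k divfK// expf_neq0// hO.
  by rewrite /k /g u0 ?mul0r// => /KO.
have chn n l : Cc_space l -> Cc_space (fun y => l y * h y ^+ n).
  move=> cl; apply: (@Cc_space_mul _ _ l (fun y => h y ^+ n) cl) => y.
  by apply: continuous_at_expr; case: ch => + _; apply.
have approx n l : Cc_space l ->
    exists2 c, J c & `|io (fun y => l y * h y ^+ n) - c| <= `|io l| * ofR d ^+ n.
  move=> cl; elim: n => [|n [c Jc cn]].
    exists 0; first exact: (ideal0 idJ).
    rewrite subr0 expr0 mulr1 (_ : (fun y => _) = l)//.
    by apply/funext => y; rewrite mulr1.
  set v := io _ in cn.
  (* Chosen so that the error becomes [(v - c) (io h - b)]. *)
  exists (cmul c (io h) + (cmul v b - cmul c b)).
    apply: idealD => //; first exact: ideal_mulr.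
    by apply: idealB => //; [exact: ideal_mull | exact: ideal_mulr].
  rewrite (_ : (fun y => _) = (fun y => (l y * h y ^+ n) * h y)); last first.
    by apply/funext => y; rewrite exprSr mulrA.
  rewrite (embedM B_max (chn n l cl) ch).
  rewrite -/v (_ : _ - _ = cmul (v - c) (io h - b)); last first.
    rewrite cmulBl !cmulBr opprD !opprB -[RHS]addrA; congr (_ + _).
    by rewrite addrCA [RHS]addrCA; congr (_ + _); exact: addrC.
  rewrite exprSr mulrA (le_trans (cmul_norm _ _))// -dE ler_wpM2r//.
  by rewrite dE.
have kn n y : `|k n y| <= ofR (t^-1 ^+ n).
  have [Ky|/u0 uy] := pselect (K y); last first.
    by rewrite /k /g uy mul0r normr0 -ofR0 ofR_le exprn_ge0// invr_ge0 ltW.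
  rewrite /k normrM normfV normrX /g ofR_norm (normr_ofR (h y)) -ofRX.
  have Oy := KO _ Ky; rewrite /O /= in Oy.
  have hy0 : 0 < reC `|h y| by exact: lt_trans Oy.
  rewrite -[X in _ / X]mulr1 -ofR1 -ofRM.
  have -> : (ofR (reC `|h y| ^+ n * 1))^-1 = ofR ((reC `|h y| ^+ n)^-1).
    rewrite mulr1; apply: (mulfI (x := ofR (reC `|h y| ^+ n))).
      by rewrite gt_eqF// -ofR0 ofR_lt exprn_gt0.
    by rewrite mulfV ?gt_eqF// -?ofRM ?mulfV ?gt_eqF ?exprn_gt0// -ofR0 ofR_lt exprn_gt0.
  rewrite -ofRM ofR_le -[leRHS]mul1r ler_pM// ?invr_ge0 ?exprn_ge0 ?reC_norm_ge0//.
    by have /andP[? ?] := u01 y; rewrite ger0_norm.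
  by rewrite -exprVn lerXn2r ?nnegrE ?invr_ge0 ?(ltW hy0) ?(ltW t0)// lef_pV2 ?posrE// ltW.
have Jg : J (io g).
  have /closure_id -> : closed J := ideal_closed idJ.
  apply/closure_approx => e e0.
  have q0 : 0 <= d / t by apply: divr_ge0 => //; exact: ltW.
  have q1 : `|d / t| < 1.
    by rewrite (ger0_norm q0) ltr_pdivrMr// mul1r; case: dt.
  have /cvgrPdist_lt /(_ _ (divr_gt0 e0 (ltr0n R 2))) [N _ /(_ N (leqnn N))] := cvg_expr q1.
  rewrite /= sub0r normrN (ger0_norm (exprn_ge0 N q0)) => qN.
  have [c Jc cN] := approx N _ (ck N); exists c => //.
  rewrite -(kh N); apply: le_lt_trans cN _.
  have tN : 0 <= t^-1 ^+ N by rewrite exprn_ge0// invr_ge0 ltW.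
  apply: le_lt_trans (ler_wpM2r _ (embed_norm B_max tN (ck N) (kn N))) _.
    by rewrite -ofRX -ofR0 ofR_le exprn_ge0.
  rewrite -mulrA -ofRX -ofRM -exprMn mulrC [t^-1 * d]mulrC.
  rewrite -(ofR_nat 2).
  by rewrite -ofRM ofR_lt -ltr_pdivlMr.
have g0 : io g = 0.
  have : (J `&` A) (io g) by split=> //; exact: embed_C0_image.
  by rewrite JA.
have := embed_ge x cg; rewrite g0 normr0 /g ux ofR1 normr1.
by rewrite ler10.
Qed.

End TriviallyMeeting.

(** The closure of the union of a chain still meets the copy of C_0(X) trivially:
    the distance estimate is uniform along the chain. *)
Lemma trivially_meeting_maximal (J0 : set B) : trivially_meeting_ideal A J0 ->
  exists2 J, maximal_trivially_meeting_ideal A J & J0 `<=` J.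
Proof.
move=> t0; pose T := {J : set B | trivially_meeting_ideal A J /\ J0 `<=` J}.
pose le (u v : T) := `[< sval u `<=` sval v >].
have [||||[J [tJ J0J]] Jmax] := @Zorn T le.
- by move=> u; apply/asboolP.
- by move=> u v w /asboolP uv /asboolP vw; apply/asboolP; exact: subset_trans vw.
- move=> [u pu] [v pv] /asboolP /= uv /asboolP /= vu; apply: eq_exist; exact/seteqP.
- move=> F Ftot; have [[u0 Fu0]|F0] := pselect (exists u, F u); last first.
    exists (exist _ J0 (conj t0 (@subset_refl _ J0))) => u Fu.
    by case: F0; exists u.
  pose S := \bigcup_(u in F) sval u.
  have SJ u : F u -> sval u `<=` S by move=> Fu b ub; exists u.
  have uP (u : T) : trivially_meeting_ideal A (sval u) /\ J0 `<=` sval u.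
    exact: (proj2_sig u).
  have idF (u : T) : closed_ideal (sval u) by have [[]] := uP u.
  have idS : closed_ideal (closure S).
    apply: closure_ideal.
    + by exists u0 => //; exact: (ideal0 (idF _)).
    + move=> z a b [u Fu ua] [v Fv vb].
      by have [/asboolP uv|/asboolP vu] := Ftot _ _ Fu Fv; [exists v|exists u] => //;
        apply: (ideal_linear (idF _)) => //; [exact: uv|exact: vu].
    + move=> a b [u Fu ub]; apply: subset_closure; exists u => //.
      exact: (ideal_mull (idF _)).
    + move=> a b [u Fu ub]; apply: subset_closure; exists u => //.
      exact: (ideal_mulr (idF _)).
  have tS : trivially_meeting_ideal A (closure S).
    split=> //; apply/seteqP; split=> [b [/closure_approx clb Ab]|_ ->].
      apply: (@C0_image_eq0 b 2) => // e g e0 cg bg x.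
      have [c [u Fu uc] bc] := clb e e0.
      apply: le_trans (@trivially_meeting_dist _ (uP u).1 g c x cg uc) _.
      rewrite -(subrKA b) (le_trans (ler_normD _ _))// mulr_natl mulr2n ofRD.
      by rewrite [`|io g - b|]distrC lerD// ltW.
    split; first exact: (ideal0 idS).
    by rewrite -(embed0 B_max); apply: embed_C0_image; exact: Cc_space0.
  have J0S : J0 `<=` closure S.
    apply: subset_trans (uP u0).2 _; apply: subset_trans (SJ _ Fu0) _.
    exact: subset_closure.
  exists (exist _ (closure S) (conj tS J0S)) => u Fu; apply/asboolP => /=.
  by apply: subset_trans (SJ _ Fu) _; exact: subset_closure.
exists J => //; split=> // J' tJ' JJ'.
have J0J' : J0 `<=` J' by exact: subset_trans JJ'.
have := Jmax (exist _ J' (conj tJ' J0J')); rewrite /le /= => /(_ (asboolT JJ')).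
by case.
Qed.

End LocalMultipliers.

(** * Topological freeness gives the hidden ideal *)

Section FreeImpliesIntersection.
Context {R : realType} {X : topologicalType} {H : etaleGroupoid X}.
Context (hX : hausdorff_space X) (lX : locally_compact [set: X]).
Local Notation C := (Cplx R).
Local Notation s := (@gsrc X H).
Local Notation r := (@grng X H).
Local Notation unit := (@gunit X H).

(** If [V] meets [U] in units, then over these units [U] has no other arrows. If
    it does not, then [U] has only non-units over [V], and topological freeness
    gives a point [x] of [V] without isotropy in [U]: the arrow of [U] at [x], if
    any, moves [x] to another point, and a small neighbourhood of [x] is moved
    off itself. If [U] has no arrow at [x], a neighbourhood of [x] avoids the
    compact support of [f]. *)
Lemma bisection_vanishing (U : set H) (f : H -> C) (V : set X) :
  topologically_free H -> bisection U -> Cc U f -> open V -> V !=set0 ->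
  exists W, [/\ open W, W !=set0, W `<=` V &
    forall a, ~ unit_arrows a -> W (s a) -> W (r a) -> f a = 0].
Proof.
move=> tf bU fU oV [v Vv]; have [oU riU siU] := bU.
have [[w [Vw Uw]]|nVU] := pselect ((V `&` unit @^-1` U) !=set0).
  exists (V `&` unit @^-1` U); split.
  - by apply: openI => //; apply: open_comp => // x _; exact: gunit_continuous.
  - by exists w.
  - exact: subIsetl.
  - move=> a na [_ Us] _; apply: (Cc_eq0 fU) => Ua; apply: na.
    by apply/unit_arrowsP; apply: siU; rewrite ?inE// gsrc_unit.
pose U' := U `&` (s @^-1` V `&` r @^-1` V).
have oU' : open U'.
  apply: openI => //; apply: openI; apply: open_comp => // a _.
  - exact: gsrc_continuous.
  - exact: grng_continuous.
have bU' : bisection U' by apply: bisectionS bU oU' _; exact: subIsetl.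
have U'n : U' `<=` ~` @unit_arrows X H.
  move=> a [Ua [Va _]] [x _ xa]; apply: nVU; exists x.
  by split; rewrite /preimage /= ?xa// -(gsrc_unit H x) xa.
have [x Vx nx] : exists2 x, V x & ~ (isotropy x `&` U' !=set0).
  apply: contrapT => nex; have := tf _ bU' U'n; apply/eqP/set0P; exists v.
  apply: (@filterS _ _ _ V); last exact: open_nbhs_nbhs.
  by move=> y Vy; apply: contrapT => ny; apply: nex; exists y.
have [[a Ua ax]|nax] := pselect ((s @` U) x).
  have rax : r a != x.
    apply/eqP => rax; apply: nx; exists a; split; first by split.
    by split => //; split; rewrite /= ?ax ?rax.
  move: hX; rewrite open_hausdorff => /(_ _ _ rax) [[Q P]] /= [/set_mem Qr /set_mem Px] [oQ oP /eqP QP].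
  exists (V `&` (P `&` s @` (U `&` r @^-1` Q))); split.
  - apply: openI => //; apply: openI => //; apply: gsrc_open; apply: openI => //.
    by apply: open_comp => // b _; exact: grng_continuous.
  - by exists x; split=> //; split=> //; exists a.
  - exact: subIsetl.
  - move=> b _ [_ [_ [c [Uc Qc] cb]]] [_ [Pb _]]; apply: (Cc_eq0 fU) => Ub.
    have e : c = b by apply: siU; rewrite ?inE.
    by have : (Q `&` P) (r b) by [split=> //; rewrite -e]; rewrite QP.
case: fU => fc [K [cK KU] K0].
exists (V `&` ~` (s @` K)); split.
- apply: openI => //; apply: closed_openC; apply: compact_closed => //.
  apply: continuous_compact => //.
  by apply: continuous_subspaceT; exact: gsrc_continuous.
- exists x; split=> // -[a Ka ax]; apply: nax; exists a => //; exact: KU.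
- exact: subIsetl.
- by move=> b _ [_ nb] _; apply: K0 => Kb; apply: nb; exists b.
Qed.

(** The exceptional sets of several bisections may have a union with nonempty
    interior, so the open set is shrunk for one bisection after the other. *)
Lemma quasi_continuous_vanishing (f : H -> C) (V : set X) :
  topologically_free H -> quasi_continuous f -> open V -> V !=set0 ->
  exists W, [/\ open W, W !=set0, W `<=` V &
    forall a, ~ unit_arrows a -> W (s a) -> W (r a) -> f a = 0].
Proof.
move=> tf qf; move: V.
elim/(@quasi_continuous_ind R X H) : qf => [|U {}f bU fU|z f1 f2 _ _ I1 I2] V oV V0.
- by exists V; split.
- exact: bisection_vanishing fU oV V0.
- have [W1 [oW1 W10 WV f10]] := I1 V oV V0.
  have [W2 [oW2 W20 W21 f20]] := I2 W1 oW1 W10.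
  exists W2; split=> //; first exact: subset_trans WV.
  move=> a na sa ra; rewrite f20// f10//; [|exact: W21|exact: W21].
  by rewrite mulr0 addr0.
Qed.

Context {B : cstarAlgebra R} {iota : (H -> C) -> B}.
Context (B_max : is_max_completion iota).
Context {M : cstarAlgebra R} {j : set X -> (X -> C) -> M}.
Context (M_loc : is_local_multiplier_algebra j).
Context {EL : B -> M} (EL_can : is_EL iota j EL).
Local Notation A := (C0_image iota).
Local Notation io := (embed iota).

Lemma compression (f : H -> C) (k : X -> C) (W : set X) :
  quasi_continuous f -> Cc_space k -> Cc_space (fun x => k x * f (unit x) * k x) ->
  (forall x, ~ W x -> k x = 0) ->
  (forall a, ~ unit_arrows a -> W (s a) -> W (r a) -> f a = 0) ->
  io (fun x => k x * f (unit x) * k x) = cmul (cmul (io k) (iota f)) (io k).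
Proof.
move=> qf ck cm k0 fW; have hom := completion_hom B_max.
have qk := quasi_continuous_unit_ext (H := H) ck.
have qkf : quasi_continuous (convolution (unit_ext k) f).
  exact: quasi_continuous_convolution.
rewrite /embed -(hom_mul hom qk qf) -(hom_mul hom qkf qk); congr iota.
rewrite convolution_unitr convolution_unitl; apply/funext => a.
have [[x _ <-]|na] := pselect (unit_arrows a).
  by rewrite unit_ext_unit grng_unit gsrc_unit.
rewrite unit_ext_out//.
have [Ws|/k0 ->] := pselect (W (s a)); last by rewrite mulr0.
have [Wr|/k0 ->] := pselect (W (r a)); last by rewrite !mul0r.
by rewrite fW// mulr0 mul0r.
Qed.

(** If [EL b] were nonzero, compressing an approximation [f] of [b] by a bump
    function would give a function on the unit space that is large, as [EL]
    is, but close to an element of [J]. *)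
Lemma free_trivially_meeting_EL (J : set B) b : topologically_free H ->
  trivially_meeting_ideal A J -> J b -> EL b = 0.
Proof.
move=> tf tJ Jb; apply/eqP; rewrite -normr_le0 normr_ofR -ofR0 ofR_le leNgt.
apply/negP => ELb; (* Compression multiplies the error [e] by at most 4, the square of the bound 2
   for the bump function, while [EL (iota f)] has norm at least [5 * e]. *)
pose e := reC `|EL b| / 6.
have e0 : 0 < e by exact: divr_gt0.
have [f qf bf] := quasi_continuous_dense B_max b e0.
have fE : ofR (4 * e) < `|EL (iota f)|.
  have : `|EL b| - `|EL (iota f)| < ofR e.
    apply: le_lt_trans (lerB_dist _ _) _; rewrite -(ELB EL_can).
    by apply: le_lt_trans (EL_contractive EL_can _) bf.
  rewrite (normr_ofR (EL b)) (normr_ofR (EL (iota f))) -ofRB !ofR_lt /e.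
  by move=> ?; lra.
have e4 : 0 <= 4 * e by lra.
have [V [[oV _] [fc _] [x Vx fx]]] := EL_large B_max M_loc EL_can e4 qf fE.
pose V1 := [set y | V y /\ ofR (4 * e) < `|f (unit y)|].
have oV1 : open V1.
  rewrite openE => y [Vy fy]; apply: filterI; first exact: open_nbhs_nbhs.
  have nc : {for y, continuous (fun y => reC `|f (unit y)|)}.
    by apply: (continuous_at_reC (f := fun y => `|f (unit y)|)); apply: cvg_norm; exact: fc.
  have : nbhs y ((fun y => reC `|f (unit y)|) @^-1` [set z : R | 4 * e < z]).
    apply: nc; apply: open_nbhs_nbhs; split; first exact: open_gt.
    by move: fy; rewrite normr_ofR ofR_lt.
  by apply: filterS => z /=; rewrite normr_ofR ofR_lt.
have V10 : V1 !=set0 by exists x.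
have [W [oW [y Wy] WV fW]] := quasi_continuous_vanishing tf qf oV1 V10.
have [u [uc [u01 uy]] [K [cK KW] u0]] := exists_bump (R := R) hX lX oW Wy.
pose k z : C := ofR (u z).
have kc : continuous k by exact: continuous_ofR.
have k0 z : ~ K z -> k z = 0 by move=> /u0 uz; rewrite /k uz.
have ck : Cc_space k by split=> //; exists K.
have cm : Cc_space (fun z => k z * f (unit z) * k z).
  apply: (Cc_space_extend hX cK KW) => [z Wz|z /k0 ->]; last by rewrite mulr0.
  apply: continuousM; last exact: kc.
  by apply: continuousM; [exact: kc | apply: fc; case: (WV _ Wz)].
have kW z : ~ W z -> k z = 0 by move=> nW; apply: k0 => /KW.
have mE := compression qf ck cm kW fW.
have k1 : `|io k| <= 2.
  rewrite -[leRHS]mulr1 -ofR1; apply: (embed_norm B_max) => // z.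
  by rewrite /k ofR_norm ofR_le; have /andP[? ?] := u01 z; rewrite ger0_norm.
have idJ := tJ.1.
have Jb' : J (cmul (cmul (io k) b) (io k)).
  by apply: (ideal_mulr idJ); exact: (ideal_mull idJ).
have := trivially_meeting_dist hX lX B_max M_loc EL_can tJ y cm Jb'.
rewrite mE -cmulBl -cmulBr /k uy ofR1 mulr1 mul1r => fy.
have [_ /lt_le_trans /(_ fy)] := WV _ Wy.
apply/negP; rewrite -real_leNgt ?ofR_real ?normr_real//.
apply: le_trans (cmul_norm _ _) _.
have -> : ofR (4 * e) = 2 * ofR e * 2 :> C.
  by rewrite ofRM ofR_nat; ring.
apply: ler_pM => //; apply: le_trans (cmul_norm _ _) _.
by apply: ler_pM => //; rewrite distrC ltW.
Qed.

Context {N : set B} (N_largest : largest_ideal_in [set b | EL b = 0] N).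

(** [EL] does not decrease sup norms of functions on the unit space. *)
Lemma EL_kernel_trivially_meeting : trivially_meeting_ideal A N.
Proof.
case: N_largest => idN NEL _; split=> //; apply/seteqP; split=> [b [Nb Ab]|_ ->].
  apply: (@C0_image_eq0 _ _ _ _ _ B_max b 1) => // e g e0 cg bg x.
  rewrite mul1r; apply: le_trans (EL_embed_ge M_loc EL_can x cg) _.
  apply: le_trans bg; rewrite distrC; apply: le_trans (EL_contractive EL_can _).
  by rewrite (ELB EL_can) (NEL _ Nb) subr0.
split; first exact: (ideal0 idN).
by rewrite -(embed0 B_max); apply: embed_C0_image; exact: Cc_space0.
Qed.

Lemma free_hidden_ideal : topologically_free H -> hidden_ideal A N.
Proof.
move=> tf; case: (N_largest) => idN NEL Nmax.
have sub J : trivially_meeting_ideal A J -> J `<=` N.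
  by move=> tJ; apply: Nmax => [|b]; [case: tJ | exact: free_trivially_meeting_EL].
have tN := EL_kernel_trivially_meeting.
split; first by split=> // J /sub JN NJ; exact/seteqP.
by move=> J [tJ Jmax]; apply: Jmax => //; exact: sub.
Qed.

End FreeImpliesIntersection.

(** * The representation on orbits *)

Section FiniteSumsMore.

Lemma fsum_seq (I : choiceType) (S : set I) : finite_set S ->
  exists t : seq I, forall (K : idomainType) (F : I -> K),
    (forall i, ~ S i -> F i = 0) ->
    \sum_(i \in [set: I]) F i = \sum_(i <- t) F i.
Proof.
move=> fS; eexists => K F F0; rewrite (fsum_widen (S := S)) ?fsbig_finite//.
by move=> i _; exact: F0.
Qed.

Lemma fsum_le (R : realDomainType) (I : choiceType) (F G : I -> R) :
  finite_set [set i | F i <> 0] -> finite_set [set i | G i <> 0] ->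
  (forall i, F i <= G i) ->
  \sum_(i \in [set: I]) F i <= \sum_(i \in [set: I]) G i.
Proof.
move=> fF fG FG; rewrite -subr_ge0 addrC -mulN1r -fsum_linear; last 2 first.
- by apply: sub_finite_set fF => i [].
- by apply: sub_finite_set fG => i [].
by apply: fsumr_ge0 => i _; rewrite mulN1r addrC subr_ge0.
Qed.

End FiniteSumsMore.

Section SquareSummable.
Context {R : realType} {X : choiceType}.
Local Notation C := (Cplx R).
Implicit Types (xi eta : X -> C).

Definition nrm (z : C) : R := reC `|z|.

Lemma nrm_ofR z : `|z| = ofR (nrm z). Proof. exact: normr_ofR. Qed.
Lemma nrm_ge0 z : 0 <= nrm z. Proof. exact: reC_norm_ge0. Qed.
Lemma nrm0 : nrm 0 = 0. Proof. by rewrite /nrm normr0. Qed.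
Lemma nrmM z w : nrm (z * w) = nrm z * nrm w.
Proof. by rewrite /nrm normrM nrm_ofR (nrm_ofR w) -ofRM. Qed.
Lemma nrmD z w : nrm (z + w) <= nrm z + nrm w.
Proof. by rewrite -ofR_le ofRD -!nrm_ofR; exact: ler_normD. Qed.
Lemma nrm_conj z : nrm z^* = nrm z. Proof. by rewrite /nrm norm_conjC. Qed.
Lemma nrm_eq0 z : nrm z = 0 -> z = 0.
Proof. by move=> z0; apply/normr0_eq0; rewrite nrm_ofR z0. Qed.

Definition finsupp xi := finite_set [set x | xi x <> 0].

Definition l2 xi : R := \sum_(x \in [set: X]) nrm (xi x) ^+ 2.
Definition dot xi eta : C := \sum_(x \in [set: X]) xi x * (eta x)^*.

Lemma finsupp_sq xi : finsupp xi -> finite_set [set x | nrm (xi x) ^+ 2 <> 0].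
Proof.
by move=> fx; apply: sub_finite_set fx => x /= h x0; apply: h; rewrite x0 nrm0 expr0n.
Qed.

Lemma l2_ge0 xi : 0 <= l2 xi.
Proof. by apply: fsumr_ge0 => x _; exact: sqr_ge0. Qed.

Lemma dot_l2 xi : finsupp xi -> dot xi xi = ofR (l2 xi).
Proof.
move=> fx; have x0 x : ~ [set x | xi x <> 0] x -> xi x = 0 by apply: contra_notP.
have [t tE] := fsum_seq fx.
rewrite /dot /l2 tE => [|x /x0 ->]; last by rewrite mul0r.
rewrite tE => [|x /x0 ->]; last by rewrite nrm0 expr0n.
rewrite (big_morph _ ofRD ofR0); apply: eq_bigr => x _.
by rewrite -normCK nrm_ofR ofRX.
Qed.

(** The arithmetic-geometric form of the Cauchy-Schwarz inequality; the free
    parameter [c] is set to an operator bound or to its square in applications. *)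
Lemma dot_le xi eta (c : R) : 0 < c -> finsupp xi -> finsupp eta ->
  nrm (dot xi eta) <= (c * l2 xi + l2 eta / c) / 2.
Proof.
move=> c0 fx fe; pose S := [set x | xi x <> 0] `|` [set x | eta x <> 0].
have fS : finite_set S by rewrite finite_setU.
have x0 x : ~ S x -> xi x = 0 by apply: contra_notP => ?; left.
have e0 x : ~ S x -> eta x = 0 by apply: contra_notP => ?; right.
have [t tE] := fsum_seq fS; rewrite /dot /l2 !tE; first last.
- by move=> x /x0 ->; rewrite mul0r.
- by move=> x /x0 ->; rewrite nrm0 expr0n.
- by move=> x /e0 ->; rewrite nrm0 expr0n.
have le z : nrm (\sum_(x <- t) z x) <= \sum_(x <- t) nrm (z x).
  elim/big_rec2: _ => [|x u v _ uv]; first by rewrite nrm0.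
  by apply: le_trans (nrmD _ _) _; rewrite lerD2l.
apply: le_trans (le _) _; rewrite mulr_sumr mulr_suml -big_split mulr_suml /=.
apply: ler_sum => x _; rewrite nrmM nrm_conj.
have -> : (c * nrm (xi x) ^+ 2 + nrm (eta x) ^+ 2 / c) / 2 =
    nrm (xi x) * nrm (eta x) + (c * nrm (xi x) - nrm (eta x)) ^+ 2 / (2 * c).
  by field; rewrite gt_eqF.
by rewrite lerDl divr_ge0 ?sqr_ge0// mulr_ge0// ltW.
Qed.

End SquareSummable.

Section OrbitRepresentation.
Context {R : realType} {X : topologicalType} {H : etaleGroupoid X}.
Local Notation C := (Cplx R).
Local Notation s := (@gsrc X H).
Local Notation r := (@grng X H).
Local Notation unit := (@gunit X H).
Implicit Types (f g : H -> C) (xi eta : X -> C).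

(** The direct sum of the trivial representations on the orbits of [H], on
    finitely supported functions on the unit space. Arrows with equal range and
    source act in the same way, so isotropy is not seen. *)
Definition orbit_op f xi : X -> C :=
  fun y => \sum_(a \in [set a | r a = y]) f a * xi (s a).

Lemma fibre_finite_source f xi : fibre_finite f -> finsupp xi ->
  finite_set [set a | f a * xi (s a) <> 0].
Proof.
move=> ff fx.
apply: (@sub_finite_set _ _ (\bigcup_(x in [set x | xi x <> 0]) [set a | s a = x /\ f a <> 0])).
  move=> a h; exists (s a) => /=.
    by move=> x0; apply: h; rewrite x0 mulr0.
  by split=> // f0; apply: h; rewrite f0 mul0r.
by apply: bigcup_finite => // x _; exact: (ff x).2.
Qed.

Lemma fibre_finite_range f xi y : fibre_finite f ->
  finite_set [set a | r a = y /\ f a * xi (s a) <> 0].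
Proof.
move=> ff; apply: sub_finite_set (ff y).1 => a [ra h]; split=> // f0.
by apply: h; rewrite f0 mul0r.
Qed.

Lemma orbit_op_finsupp f xi : fibre_finite f -> finsupp xi -> finsupp (orbit_op f xi).
Proof.
move=> ff fx; apply: sub_finite_set (finite_image r (fibre_finite_source ff fx)) => y /= h.
apply: contrapT => ny; apply: h; apply: fsbig1 => a /= ay.
by apply: contrapT => h; apply: ny; exists a.
Qed.

Lemma orbit_op_linear (z : C) f g xi : fibre_finite f -> fibre_finite g ->
  orbit_op (fun a => z * f a + g a) xi =
  (fun x => z * orbit_op f xi x + orbit_op g xi x).
Proof.
move=> ff fg; apply/funext => y; rewrite /orbit_op -fsum_linear.
- by apply: eq_fsbigr => a _; rewrite mulrDl mulrA.
- exact: fibre_finite_range.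
- exact: fibre_finite_range.
Qed.

Lemma orbit_op_convolution f g xi : fibre_finite f -> fibre_finite g ->
  orbit_op (convolution f g) xi = orbit_op f (orbit_op g xi).
Proof.
move=> ff fg; apply/funext => y; rewrite /orbit_op /convolution.
have -> : \sum_(a \in [set a | r a = y])
      (\sum_(b \in [set b | r b = r a]) f b * g (gmul (ginv b) a)) * xi (s a) =
    \sum_(a \in [set a | r a = y]) \sum_(b \in [set b | r b = y])
      f b * g (gmul (ginv b) a) * xi (s a).
  by apply: eq_fsbigr => a /set_mem /= ->; rewrite mulr_fsuml.
rewrite fsum_exchange.
  apply: eq_fsbigr => b /set_mem /= rb; rewrite mulr_fsumr.
  rewrite (reindex_fsbig (gmul b) [set c | r c = s b]).
    apply: eq_fsbigr => c /set_mem /= rc.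
    by rewrite gmulKV// gsrc_mul// mulrA.
  split.
  - by move=> c /= rc; rewrite grng_mul.
  - move=> c d /set_mem /= rc /set_mem /= rd e.
    by rewrite -(@gmulKV _ _ b c)// e gmulKV.
  - move=> a /= ra; exists (gmul (ginv b) a); last by rewrite gmulVK// rb ra.
    by rewrite /= grng_mul ?gsrc_inv ?grng_inv// rb ra.
pose S := \bigcup_(b in [set b | r b = y /\ f b <> 0])
  ((fun c => (gmul b c, b)) @` [set c | r c = s b /\ g c <> 0]).
apply: (@sub_finite_set _ _ S).
  move=> [a b] [/= ra rb h]; exists b => /=.
    by split=> // f0; apply: h; rewrite f0 !mul0r.
  exists (gmul (ginv b) a); last by rewrite gmulVK// rb ra.
  split; first by rewrite grng_mul ?gsrc_inv ?grng_inv// rb ra.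
  by move=> g0; apply: h; rewrite g0 mulr0 mul0r.
apply: bigcup_finite; first exact: (ff y).1.
by move=> b _; apply: finite_image; exact: (fg (s b)).1.
Qed.

Lemma conj_fsum (I : choiceType) (A : set I) (F : I -> C) :
  finite_set [set i | A i /\ F i <> 0] ->
  (\sum_(i \in A) F i)^* = \sum_(i \in A) (F i)^*.
Proof.
set S := [set i | _] => fS.
have SA : S `<=` A by move=> i [].
have F0 i : A i -> ~ S i -> F i = 0 by move=> Ai; apply: contra_notP.
rewrite !(fsum_widen SA)// ?fsbig_finite//= ?rmorph_sum// => i Ai Si.
by rewrite F0// rmorph0.
Qed.

Lemma fibre_finite_invol f : fibre_finite f -> fibre_finite (invol f).
Proof.
move=> ff x; split.
- apply: sub_finite_set (finite_image (@ginv X H) (ff x).2) => a [ra h].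
  exists (ginv a); last by rewrite ginvK.
  by split; [rewrite gsrc_inv | move=> f0; apply: h; rewrite /invol f0 rmorph0].
- apply: sub_finite_set (finite_image (@ginv X H) (ff x).1) => a [ra h].
  exists (ginv a); last by rewrite ginvK.
  by split; [rewrite grng_inv | move=> f0; apply: h; rewrite /invol f0 rmorph0].
Qed.

Lemma involK f : invol (invol f) = f.
Proof. by apply/funext => a; rewrite /invol conjCK ginvK. Qed.

(** Both sides are sums over all arrows, exchanged by inversion. *)
Lemma orbit_op_adjoint f xi eta : fibre_finite f -> finsupp xi -> finsupp eta ->
  dot (orbit_op f xi) eta = dot xi (orbit_op (invol f) eta).
Proof.
move=> ff fx fe; have ff' := fibre_finite_invol ff.
transitivity (\sum_(a \in [set: H]) f a * xi (s a) * (eta (r a))^*).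
  rewrite -(fsum_fibre r); last first.
    apply: sub_finite_set (fibre_finite_source ff fx) => a /= h h0.
    by apply: h; rewrite h0 mul0r.
  apply: eq_fsbigr => y _; rewrite /orbit_op mulr_fsuml.
  by apply: eq_fsbigr => a /set_mem /= <-.
rewrite (reindex_fsbigT (@ginv X H)); last by exists (@ginv X H); exact: ginvK.
transitivity (\sum_(a \in [set: H]) xi (r a) * (invol f a * eta (s a))^*).
  apply: eq_fsbigr => a _; rewrite gsrc_inv grng_inv rmorphM /= /invol conjCK.
  by rewrite mulrA [xi _ * _]mulrC.
rewrite -(fsum_fibre r); last first.
  apply: sub_finite_set (fibre_finite_source ff' fe) => a /= h h0.
  by apply: h; rewrite h0 rmorph0 mulr0.
apply: eq_fsbigr => y _; rewrite /orbit_op conj_fsum; last exact: fibre_finite_range.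
by rewrite mulr_fsumr; apply: eq_fsbigr => a /set_mem /= <-.
Qed.

End OrbitRepresentation.

(** * The operator norm of the orbit representation *)

Section OrbitNorm.
Context {R : realType} {X : topologicalType} {H : etaleGroupoid X}.
Local Notation C := (Cplx R).
Local Notation s := (@gsrc X H).
Local Notation r := (@grng X H).
Local Notation unit := (@gunit X H).
Implicit Types (f g : H -> C) (xi eta : X -> C) (K : R).

Definition orbit_bound f K :=
  0 < K /\ forall xi, finsupp xi -> l2 (orbit_op f xi) <= K ^+ 2 * l2 xi.

(** The operator norm on the pre-Hilbert space of finitely supported functions,
    as the infimum of all positive bounds. *)
Definition orbit_norm f : R := inf [set K | orbit_bound f K].

Definition orbit_bounded f := fibre_finite f /\ exists K, orbit_bound f K.

Lemma orbit_norm_le f K : orbit_bound f K -> orbit_norm f <= K.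
Proof.
by move=> fK; apply: ge_inf => //; exists 0 => L [/ltW].
Qed.

Lemma orbit_norm_ge0 f : orbit_bounded f -> 0 <= orbit_norm f.
Proof.
by move=> [_ [K fK]]; apply: lb_le_inf; [exists K | move=> L [/ltW]].
Qed.

Lemma orbit_norm_lt f K : orbit_bounded f -> orbit_norm f < K -> orbit_bound f K.
Proof.
move=> [_ [K0 fK0]] fK; have e0 : 0 < K - orbit_norm f by rewrite subr_gt0.
have hi : has_inf [set K | orbit_bound f K].
  by split; [exists K0 | exists 0 => L [/ltW]].
have [L [L0 fL]] := inf_adherent e0 hi.
rewrite -/(orbit_norm f) subrKC => LK; split; first exact: lt_trans LK.
move=> xi fx; apply: le_trans (fL _ fx) _; apply: ler_wpM2r; first exact: l2_ge0.
by rewrite ler_pXn2r ?nnegrE ?ltW// (lt_trans L0).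
Qed.

Lemma orbit_norm_bounds f (c : R) : 0 <= c ->
  (forall K, c < K -> orbit_bound f K) -> orbit_norm f <= c.
Proof.
move=> c0 cK; apply/ler_addgt0Pl => e e0; apply: orbit_norm_le; apply: cK.
by rewrite ltrDr.
Qed.

Lemma l2_le_linear (u v w : X -> C) (c d : R) :
  finsupp u -> finsupp v -> finsupp w ->
  (forall x, nrm (w x) ^+ 2 <= c * nrm (u x) ^+ 2 + d * nrm (v x) ^+ 2) ->
  l2 w <= c * l2 u + d * l2 v.
Proof.
move=> fu fv fw h; have fu' := finsupp_sq fu; have fv' := finsupp_sq fv.
have fdv : finite_set [set x | d * nrm (v x) ^+ 2 <> 0].
  by apply: sub_finite_set fv' => x /= h1 h2; apply: h1; rewrite h2 mulr0.
rewrite /l2 (mulr_fsumr d) -fsum_linear.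
- apply: fsum_le => //; first exact: finsupp_sq.
  apply: (@sub_finite_set _ _ ([set x | nrm (u x) ^+ 2 <> 0] `|`
    [set x | d * nrm (v x) ^+ 2 <> 0])); last by rewrite finite_setU.
  move=> x /= h1; have [h2|/eqP] := eqVneq (nrm (u x) ^+ 2) 0; last by left.
  by right => h3; apply: h1; rewrite h2 h3 mulr0 addr0.
- by apply: sub_finite_set fu' => x [].
- by apply: sub_finite_set fdv => x [].
Qed.

(** Pointwise, the square of [p + q] is at most
    [(K + L) * (p^2 / K + q^2 / L)], which after summation gives the bound
    [(K + L)^2]. *)
Lemma orbit_bound_add f g K L : fibre_finite f -> fibre_finite g ->
  orbit_bound f K -> orbit_bound g L ->
  orbit_bound (fun a => f a + g a) (K + L).
Proof.
move=> ff fg [K0 fK] [L0 gL]; split=> [|xi fx]; first exact: addr_gt0.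
have E : orbit_op (fun a => f a + g a) xi = (fun x => orbit_op f xi x + orbit_op g xi x).
  have := orbit_op_linear 1 xi ff fg => h.
  transitivity (orbit_op (fun a => 1 * f a + g a) xi).
    by congr (orbit_op _ xi); apply/funext => a; rewrite mul1r.
  by rewrite h; apply/funext => x; rewrite mul1r.
have ffg : fibre_finite (fun a => f a + g a).
  have := fibre_finite_linear 1 ff fg; congr fibre_finite.
  by apply/funext => a; rewrite mul1r.
have fu := orbit_op_finsupp ff fx; have fv := orbit_op_finsupp fg fx.
have fw := orbit_op_finsupp ffg fx.
have K0' : K != 0 by rewrite gt_eqF.
have L0' : L != 0 by rewrite gt_eqF.
apply: le_trans (@l2_le_linear _ _ _ ((K + L) / K) ((K + L) / L) fu fv fw _) _.
  move=> x; rewrite E; set p := nrm (orbit_op f xi x); set q := nrm (orbit_op g xi x).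
  have p0 : 0 <= p by exact: nrm_ge0.
  have q0 : 0 <= q by exact: nrm_ge0.
  apply: (@le_trans _ _ ((p + q) ^+ 2)).
    by rewrite lerXn2r ?nnegrE ?nrm_ge0 ?addr_ge0// nrmD.
  rewrite -subr_ge0.
  have -> : (K + L) / K * p ^+ 2 + (K + L) / L * q ^+ 2 - (p + q) ^+ 2 =
      (L * p - K * q) ^+ 2 / (K * L) by field; rewrite K0' L0'.
  by rewrite divr_ge0 ?sqr_ge0//; exact/ltW/mulr_gt0.
have c0 : 0 <= (K + L) / K by rewrite divr_ge0 ?addr_ge0 ?ltW.
have d0 : 0 <= (K + L) / L by rewrite divr_ge0 ?addr_ge0 ?ltW.
apply: le_trans (lerD (ler_wpM2l c0 (fK _ fx)) (ler_wpM2l d0 (gL _ fx))) _.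
by rewrite le_eqVlt; apply/orP; left; apply/eqP; field; rewrite K0' L0'.
Qed.

Lemma orbit_bound_scale (z : C) f K L : fibre_finite f -> orbit_bound f K ->
  0 < L -> nrm z * K <= L -> orbit_bound (fun a => z * f a) L.
Proof.
move=> ff [K0 fK] L0 zKL; split=> // xi fx.
have -> : orbit_op (fun a => z * f a) xi = (fun x => z * orbit_op f xi x).
  have := orbit_op_linear z xi ff fibre_finite0 => h.
  transitivity (orbit_op (fun a => z * f a + 0) xi).
    by congr (orbit_op _ xi); apply/funext => a; rewrite addr0.
  rewrite h; apply/funext => x; rewrite -[RHS]addr0; congr (_ + _).
  by apply: fsbig1 => a _; rewrite mul0r.
have -> : l2 (fun x => z * orbit_op f xi x) = nrm z ^+ 2 * l2 (orbit_op f xi).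
  by rewrite /l2 mulr_fsumr; apply: eq_fsbigr => x _; rewrite nrmM exprMn.
apply: le_trans (ler_wpM2l (sqr_ge0 _) (fK _ fx)) _.
rewrite mulrA -exprMn ler_wpM2r ?l2_ge0// lerXn2r ?nnegrE ?(ltW L0)//.
by rewrite mulr_ge0 ?nrm_ge0// ltW.
Qed.

Lemma orbit_bound_convolution f g K L : fibre_finite f -> fibre_finite g ->
  orbit_bound f K -> orbit_bound g L -> orbit_bound (convolution f g) (K * L).
Proof.
move=> ff fg [K0 fK] [L0 gL]; split=> [|xi fx]; first exact: mulr_gt0.
rewrite orbit_op_convolution//.
apply: le_trans (fK _ (orbit_op_finsupp fg fx)) _.
rewrite (_ : (K * L) ^+ 2 * l2 xi = K ^+ 2 * (L ^+ 2 * l2 xi)); last by ring.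
by rewrite ler_wpM2l ?sqr_ge0// gL.
Qed.

(** Write T for the operator of [f]. The square norm of [T^* xi] is the inner
    product of [xi] and [T T^* xi], at most half of [K^2 |xi|^2 + |T^* xi|^2] when
    the parameter of [dot_le] is [K^2]; subtracting gives the bound. *)
Lemma orbit_bound_invol f K : fibre_finite f -> orbit_bound f K ->
  orbit_bound (invol f) K.
Proof.
move=> ff [K0 fK]; split=> // xi fx; have ff' := fibre_finite_invol ff.
have f1 := orbit_op_finsupp ff' fx; have f2 := orbit_op_finsupp ff f1.
have K2 : 0 < K ^+ 2 by exact: exprn_gt0.
have := orbit_op_adjoint ff' fx f1; rewrite involK dot_l2// => e.
have := dot_le K2 fx f2; rewrite -e {1}/nrm ofR_norm ofRK ger0_norm ?l2_ge0//.
have := fK _ f1; rewrite -ler_pdivrMl// [_^-1 * _]mulrC.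
set u := _ / _; set v := l2 (orbit_op _ _); set w := _ * l2 xi.
by move=> ? ?; lra.
Qed.

(** The nontrivial half of the C*-identity: the square norm of [T xi] is the inner
    product of [xi] and [T^* T xi]. *)
Lemma orbit_bound_cstar f K : fibre_finite f -> fibre_finite (convolution (invol f) f) ->
  orbit_bound (convolution (invol f) f) K -> orbit_bound f (Num.sqrt K).
Proof.
move=> ff fff [K0 fK]; split=> [|xi fx]; first by rewrite sqrtr_gt0.
have ff' := fibre_finite_invol ff.
have f1 := orbit_op_finsupp ff fx.
rewrite (sqr_sqrtr (ltW K0)); have := orbit_op_adjoint ff fx f1.
rewrite -orbit_op_convolution// dot_l2// => e.
have := dot_le K0 fx (orbit_op_finsupp fff fx).
rewrite -e {1}/nrm ofR_norm ofRK ger0_norm ?l2_ge0//.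
have := fK _ fx; rewrite expr2 -mulrA -ler_pdivrMl// [_^-1 * _]mulrC.
set u := _ / _; set v := l2 (orbit_op _ _); set w := _ * l2 xi.
by move=> ? ?; lra.
Qed.

(** A function carried by a bisection acts as a weighted partial permutation of
    the unit space. *)
Lemma orbit_bound_bisection (U : set H) f (m : R) : bisection U ->
  (forall a, ~ U a -> f a = 0) -> 0 < m -> (forall a, nrm (f a) <= m) ->
  orbit_bound f m.
Proof.
move=> bU f0 m0 fm; split=> // xi fx.
have ff := fibre_finite_supp bU f0; have [oU riU siU] := bU.
have fin : finite_set [set a | nrm (f a * xi (s a)) ^+ 2 <> 0].
  apply: sub_finite_set (fibre_finite_source ff fx) => a /= h h0.
  by apply: h; rewrite h0 nrm0 expr0n.
have -> : l2 (orbit_op f xi) = \sum_(a \in [set: H]) nrm (f a * xi (s a)) ^+ 2.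
  rewrite -(fsum_fibre r)//; apply: eq_fsbigr => y _; rewrite /orbit_op.
  have [[a [Ua ay]]|na] := pselect (exists a, U a /\ r a = y).
    have z b : r b = y -> b <> a -> f b = 0.
      move=> yb ba; apply: f0 => Ub; apply: ba.
      by apply: riU; rewrite ?inE// yb.
    rewrite !(@fsum_single _ _ _ a)// => b /= yb ba.
      by rewrite (z b)// mul0r.
    by rewrite (z b)// mul0r nrm0 expr0n.
  rewrite !fsbig1 ?nrm0 ?expr0n// => b /= yb.
    by rewrite f0 ?mul0r ?nrm0 ?expr0n// => Ub; apply: na; exists b.
  by rewrite f0 ?mul0r// => Ub; apply: na; exists b.
have fsq := finsupp_sq fx.
have le x : \sum_(a \in [set a | s a = x]) nrm (f a * xi (s a)) ^+ 2 <=
    m ^+ 2 * nrm (xi x) ^+ 2.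
  have [[a [Ua ax]]|na] := pselect (exists a, U a /\ s a = x).
    rewrite (@fsum_single _ _ _ a)//.
      rewrite ax nrmM exprMn ler_wpM2r ?sqr_ge0// lerXn2r ?nnegrE ?nrm_ge0//.
      exact: ltW.
    move=> b /= xb ba; rewrite f0 ?mul0r ?nrm0 ?expr0n// => Ub; apply: ba.
    by apply: siU; rewrite ?inE// xb.
  rewrite fsbig1; first by rewrite mulr_ge0 ?sqr_ge0.
  by move=> b /= xb; rewrite f0 ?mul0r ?nrm0 ?expr0n// => Ub; apply: na; exists b.
rewrite -(fsum_fibre s)// /l2 mulr_fsumr; apply: fsum_le => //.
- apply: sub_finite_set fx => x /= h x0; apply: h.
  by apply: fsbig1 => a /= ->; rewrite x0 mulr0 nrm0 expr0n.
- by apply: sub_finite_set fsq => x /= h h0; apply: h; rewrite h0 mulr0.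
Qed.

Lemma orbit_op0 xi : orbit_op (fun _ : H => 0) xi = (fun=> 0).
Proof. by apply/funext => y; apply: fsbig1 => a _; rewrite mul0r. Qed.

Lemma l2_0 : l2 (fun _ : X => 0 : C) = 0.
Proof. by apply: fsbig1 => x _; rewrite nrm0 expr0n. Qed.

Lemma orbit_bound_vanish f K : 0 < K -> (forall xi, orbit_op f xi = (fun=> 0)) ->
  orbit_bound f K.
Proof.
move=> K0 f0; split=> // xi _; rewrite f0 l2_0.
by rewrite mulr_ge0 ?sqr_ge0 ?l2_ge0.
Qed.

Lemma orbit_norm_vanish f : fibre_finite f -> (forall xi, orbit_op f xi = (fun=> 0)) ->
  orbit_norm f = 0.
Proof.
move=> ff f0; apply/eqP; rewrite eq_le; apply/andP; split.
  by apply: orbit_norm_bounds => // K K0; exact: orbit_bound_vanish.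
apply: orbit_norm_ge0; split=> //; exists 1; exact: orbit_bound_vanish.
Qed.

Lemma quasi_continuous_bounded f : quasi_continuous f -> orbit_bounded f.
Proof.
move=> qf; split; first exact: quasi_continuous_fibre_finite.
elim/(@quasi_continuous_ind R X H) : qf => [|U {}f bU fU|z f1 f2 q1 q2 [K fK] [L fL]].
- by exists 1; apply: orbit_bound_vanish => // xi; exact: orbit_op0.
(* Bounds are positive by definition, hence the added 1 here and below. *)
- have [m m0 fm] := Cc_bounded fU; exists (m + 1).
  apply: (orbit_bound_bisection bU) => [a||a]; first exact: (Cc_eq0 fU).
    by rewrite ltr_wpDl.
  by rewrite -ofR_le -nrm_ofR (le_trans (fm a))// ofR_le lerDl.
- have ff1 := quasi_continuous_fibre_finite q1.
  have zq : fibre_finite (fun a => z * f1 a).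
    have := fibre_finite_linear z ff1 fibre_finite0; congr fibre_finite.
    by apply/funext => a; rewrite addr0.
  exists (nrm z * K + 1 + L); apply: orbit_bound_add fL => //.
    exact: quasi_continuous_fibre_finite.
  have [K0 _] := fK; apply: (orbit_bound_scale ff1 fK); last by rewrite lerDl.
  by rewrite ltr_wpDl// mulr_ge0 ?nrm_ge0// ltW.
Qed.

Lemma orbit_bounded_invol f : orbit_bounded f -> orbit_bounded (invol f).
Proof.
move=> [ff [K fK]]; split; first exact: fibre_finite_invol.
by exists K; exact: orbit_bound_invol.
Qed.

Lemma orbit_norm_invol f : orbit_bounded f -> orbit_norm (invol f) = orbit_norm f.
Proof.
have le g : orbit_bounded g -> orbit_norm (invol g) <= orbit_norm g.
  move=> bg; apply: orbit_norm_bounds; first exact: orbit_norm_ge0.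
  by move=> K gK; apply: orbit_bound_invol; [case: bg | exact: orbit_norm_lt].
move=> bf; apply/eqP; rewrite eq_le le//=.
by rewrite -{1}(involK f) le//; exact: orbit_bounded_invol.
Qed.

Lemma fibre_finite_convolution f g : fibre_finite f -> fibre_finite g ->
  fibre_finite (convolution f g).
Proof.
move=> ff fg; have supp a : convolution f g a <> 0 ->
    exists b c, [/\ f b <> 0, g c <> 0, s b = r c & a = gmul b c].
  move=> h; apply: contrapT => nbc; apply: h; apply: fsbig1 => b /= ba.
  apply: contrapT => h; apply: nbc; exists b, (gmul (ginv b) a); split.
  - by move=> f0; apply: h; rewrite f0 mul0r.
  - by move=> g0; apply: h; rewrite g0 mulr0.
  - by rewrite grng_mul ?gsrc_inv ?grng_inv.
  - by rewrite gmulVK.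
move=> x; split.
- apply: (@sub_finite_set _ _ (\bigcup_(b in [set b | r b = x /\ f b <> 0])
    (gmul b @` [set c | r c = s b /\ g c <> 0]))).
    move=> a [ra /supp [b [c [fb gc bc e]]]]; exists b.
      by split=> //; rewrite -ra e grng_mul.
    by exists c.
  apply: bigcup_finite; first exact: (ff x).1.
  by move=> b _; apply: finite_image; exact: (fg (s b)).1.
- apply: (@sub_finite_set _ _ (\bigcup_(c in [set c | s c = x /\ g c <> 0])
    ((fun b => gmul b c) @` [set b | s b = r c /\ f b <> 0]))).
    move=> a [sa /supp [b [c [fb gc bc e]]]]; exists c.
      by split=> //; rewrite -sa e gsrc_mul.
    by exists b.
  apply: bigcup_finite; first exact: (fg x).2.
  by move=> c _; apply: finite_image; exact: (ff (r c)).2.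
Qed.

Lemma orbit_bounded_convolution f g : orbit_bounded f -> orbit_bounded g ->
  orbit_bounded (convolution f g).
Proof.
move=> [ff [K fK]] [fg [L gL]]; split; first exact: fibre_finite_convolution.
by exists (K * L); exact: orbit_bound_convolution.
Qed.

Lemma orbit_norm_convolution f g : orbit_bounded f -> orbit_bounded g ->
  orbit_norm (convolution f g) <= orbit_norm f * orbit_norm g.
Proof.
move=> bf bg; have pf := orbit_norm_ge0 bf; have pg := orbit_norm_ge0 bg.
have bound K L : orbit_norm f < K -> orbit_norm g < L ->
    orbit_norm (convolution f g) <= K * L.
  move=> fK gL; apply: orbit_norm_le; apply: orbit_bound_convolution.
  - by case: bf. - by case: bg.
  - exact: orbit_norm_lt. - exact: orbit_norm_lt.
(* The slack [e] makes (p + e)(q + e) exceed pq by at most [d]. *)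
apply/ler_addgt0Pl => d d0.
set p := orbit_norm f in pf bound *; set q := orbit_norm g in pg bound *.
pose e := Num.min 1 (d / (p + q + 1)).
have pq1 : 0 < p + q + 1 by rewrite ltr_wpDl// addr_ge0.
have e0 : 0 < e by rewrite lt_min ltr01 divr_gt0.
have e1 : e <= 1 by rewrite ge_min lexx.
have ed : e * (p + q + 1) <= d by rewrite -ler_pdivlMr// ge_min lexx orbT.
apply: le_trans (bound (p + e) (q + e) _ _) _; rewrite ?ltrDl//.
rewrite (_ : (p + e) * (q + e) = e * (p + q + e) + p * q); last by ring.
rewrite lerD2r; apply: le_trans ed; rewrite ler_wpM2l ?(ltW e0)// lerD2l//.
Qed.

Lemma orbit_norm_cstar f : orbit_bounded f ->
  orbit_norm (convolution (invol f) f) = orbit_norm f ^+ 2.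
Proof.
move=> bf; have bi := orbit_bounded_invol bf; have bc := orbit_bounded_convolution bi bf.
apply/eqP; rewrite eq_le; apply/andP; split.
  by apply: le_trans (orbit_norm_convolution bi bf) _; rewrite orbit_norm_invol.
have c0 := orbit_norm_ge0 bc.
have le : orbit_norm f <= Num.sqrt (orbit_norm (convolution (invol f) f)).
  apply: orbit_norm_bounds => [|K cK]; first exact: sqrtr_ge0.
  have K0 : 0 < K by apply: le_lt_trans cK; exact: sqrtr_ge0.
  rewrite -(ger0_norm (ltW K0)) -sqrtr_sqr.
  apply: orbit_bound_cstar; first by case: bf.
    by case: bc.
  apply: orbit_norm_lt => //; rewrite -(sqr_sqrtr c0).
  by rewrite ltr_pXn2r ?nnegrE ?sqrtr_ge0// ltW.
rewrite -[leRHS](sqr_sqrtr c0) lerXn2r ?nnegrE ?sqrtr_ge0//.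
exact: orbit_norm_ge0.
Qed.

Lemma orbit_normD f g : orbit_bounded f -> orbit_bounded g ->
  orbit_norm (fun a => f a + g a) <= orbit_norm f + orbit_norm g.
Proof.
move=> bf bg; apply: orbit_norm_bounds.
  by rewrite addr_ge0// orbit_norm_ge0.
move=> K fgK; pose e := (K - (orbit_norm f + orbit_norm g)) / 2.
have e0 : 0 < e by rewrite /e; lra.
rewrite (_ : K = (orbit_norm f + e) + (orbit_norm g + e)); last by rewrite /e; lra.
apply: orbit_bound_add; [by case: bf|by case: bg| |].
- by apply: orbit_norm_lt; rewrite ?ltrDl.
- by apply: orbit_norm_lt; rewrite ?ltrDl.
Qed.

Lemma orbit_norm_scale_le (z : C) f : orbit_bounded f ->
  orbit_norm (fun a => z * f a) <= nrm z * orbit_norm f.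
Proof.
move=> bf; have f0 := orbit_norm_ge0 bf.
have zf0 : 0 <= nrm z * orbit_norm f by rewrite mulr_ge0 ?nrm_ge0.
apply: orbit_norm_bounds => // K zK; have K0 := le_lt_trans zf0 zK.
have ff : fibre_finite f by case: bf.
have [z0|zn0] := eqVneq (nrm z) 0.
  case: bf => _ [L fL]; apply: (orbit_bound_scale ff fL K0).
  by rewrite z0 mul0r ltW.
have zp : 0 < nrm z by rewrite lt_neqAle eq_sym zn0 nrm_ge0.
apply: (orbit_bound_scale (K := K / nrm z) ff) => //; last by rewrite mulrC divfK.
by apply: orbit_norm_lt => //; rewrite ltr_pdivlMr// mulrC.
Qed.

Lemma orbit_normZ (z : C) f : orbit_bounded f -> orbit_bounded (fun a => z * f a) ->
  orbit_norm (fun a => z * f a) = nrm z * orbit_norm f.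
Proof.
move=> bf bzf; apply/eqP; rewrite eq_le orbit_norm_scale_le//=.
have [z0|z0] := eqVneq z 0.
  by rewrite {1}z0 nrm0 mul0r; exact: orbit_norm_ge0.
have := orbit_norm_scale_le z^-1 bzf.
under eq_fun do rewrite mulKf//.
have zp : 0 < nrm z.
  by rewrite lt_neqAle nrm_ge0 andbT eq_sym; apply: contra_neq z0; exact: nrm_eq0.
have -> : nrm z^-1 = (nrm z)^-1.
  apply: (mulfI (x := nrm z)); first by rewrite gt_eqF.
  by rewrite -nrmM !mulfV// ?gt_eqF// /nrm normr1.
by rewrite mulrC ler_pdivlMr// mulrC.
Qed.

Lemma orbit_cstar_seminorm :
  cstar_seminorm (fun f => ofR (orbit_norm f)).
Proof.
split.
- move=> f /quasi_continuous_bounded bf; rewrite -ofR0 ofR_le; exact: orbit_norm_ge0.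
- move=> z f qf; rewrite nrm_ofR -ofRM orbit_normZ//; apply: quasi_continuous_bounded => //.
  have := quasi_continuous_linear z qf quasi_continuous0; congr quasi_continuous.
  by apply/funext => a; rewrite addr0.
- move=> f g /quasi_continuous_bounded bf /quasi_continuous_bounded bg.
  by rewrite -ofRD ofR_le; exact: orbit_normD.
- move=> f g /quasi_continuous_bounded bf /quasi_continuous_bounded bg.
  by rewrite -ofRM ofR_le; exact: orbit_norm_convolution.
- move=> f /quasi_continuous_bounded bf.
  by rewrite -ofRX orbit_norm_cstar.
Qed.

Lemma orbit_op_unit_ext (g : X -> C) xi :
  orbit_op (unit_ext (H := H) g) xi = (fun x => g x * xi x).
Proof.
apply/funext => x; rewrite /orbit_op (@fsum_single _ _ _ (unit x)).
- by rewrite unit_ext_unit gsrc_unit.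
- by rewrite /= grng_unit.
- move=> a /= ax na; rewrite unit_ext_out ?mul0r// => -[y _ ya]; apply: na.
  by rewrite -ya -ax -ya grng_unit.
Qed.

(** Functions on the unit space act by multiplication; test on a point mass. *)
Lemma orbit_norm_unit_ext (g : X -> C) x : Cc_space g ->
  `|g x| <= ofR (orbit_norm (unit_ext (H := H) g)).
Proof.
move=> cg; rewrite nrm_ofR ofR_le.
have [_ bg] := quasi_continuous_bounded (quasi_continuous_unit_ext (H := H) cg).
apply: lb_le_inf => // K [K0 gK].
pose d y : C := if y == x then 1 else 0.
have dP y : y <> x -> d y = 0 by rewrite /d => /eqP /negbTE ->.
have dx : d x = 1 by rewrite /d eqxx.
have fd : finsupp d.
  apply: (@sub_finite_set _ _ [set x]) => // y /= h.
  by apply: contrapT => /dP.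
have := gK d fd; rewrite orbit_op_unit_ext /l2.
rewrite !(@fsum_single _ _ _ x)//; first last.
- by move=> y _ /dP ->; rewrite mulr0 nrm0 expr0n.
- by move=> y _ /dP ->; rewrite nrm0 expr0n.
rewrite dx mulr1 [nrm 1]/nrm normr1 expr1n mulr1.
by rewrite ler_pXn2r ?nnegrE ?nrm_ge0// ltW.
Qed.

End OrbitNorm.

(** * Failure of topological freeness *)

Section IntersectionImpliesFree.
Context {R : realType} {X : topologicalType} {H : etaleGroupoid X}.
Context (hX : hausdorff_space X) (lX : locally_compact [set: X]).
Context {B : cstarAlgebra R} {iota : (H -> Cplx R) -> B}.
Context (B_max : is_max_completion iota).
Context {M : cstarAlgebra R} {j : set X -> (X -> Cplx R) -> M}.
Context (M_loc : is_local_multiplier_algebra j).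
Context {EL : B -> M} (EL_can : is_EL iota j EL).
Local Notation C := (Cplx R).
Local Notation s := (@gsrc X H).
Local Notation r := (@grng X H).
Local Notation unit := (@gunit X H).
Local Notation A := (C0_image iota).
Local Notation io := (embed iota).

(** The kernel in the completion of the orbit representation contains this
    ideal, which is large enough and avoids extending the representation. *)
Definition orbit_kernel : set B :=
  closure [set b | exists f, [/\ quasi_continuous f, orbit_norm f = 0 & b = iota f]].

(** This is where the maximality of the completion enters. *)
Lemma orbit_norm_le_iota f : quasi_continuous f -> ofR (orbit_norm f) <= `|iota f|.
Proof. exact: (completion_max B_max (@orbit_cstar_seminorm R X H)). Qed.

Lemma orbit_norm_eq0 (f : H -> C) : quasi_continuous f -> orbit_norm f <= 0 -> orbit_norm f = 0.
Proof.
move=> /quasi_continuous_bounded /orbit_norm_ge0 f0 f1.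
by apply/eqP; rewrite eq_le f1.
Qed.

Lemma orbit_kernel_ideal : closed_ideal orbit_kernel.
Proof.
have hom := completion_hom B_max.
have approx (a b : B) (e : R) : 0 < e ->
    exists2 g, quasi_continuous g & `|a - iota g| * `|b| < ofR e.
  move=> e0; have b1 : 0 < reC `|b| + 1 by rewrite ltr_wpDl// reC_norm_ge0.
  have [g qg ag] := quasi_continuous_dense B_max a (divr_gt0 e0 b1).
  exists g => //; rewrite (normr_ofR (a - iota g)) (normr_ofR b) -ofRM ofR_lt.
  rewrite (normr_ofR (a - iota g)) ofR_lt ltr_pdivlMr// in ag.
  by apply: le_lt_trans ag; rewrite ler_wpM2l ?reC_norm_ge0// lerDl.
apply: closure_ideal.
- exists (fun=> 0); split; [exact: quasi_continuous0| |by rewrite (iota0 B_max)].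
  by apply: orbit_norm_vanish => [|xi]; [exact: fibre_finite0 | exact: orbit_op0].
- move=> z _ _ [f [qf f0 ->]] [g [qg g0 ->]]; exists (fun a => z * f a + g a).
  have bf := quasi_continuous_bounded qf; have bg := quasi_continuous_bounded qg.
  have qzf : quasi_continuous (fun a => z * f a).
    have := quasi_continuous_linear z qf quasi_continuous0; congr quasi_continuous.
    by apply/funext => a; rewrite addr0.
  have qzfg := quasi_continuous_linear z qf qg.
  split=> //; last by rewrite (iota_linear B_max).
  apply: orbit_norm_eq0 => //.
  apply: le_trans (orbit_normD (quasi_continuous_bounded qzf) bg) _.
  by rewrite g0 addr0 (le_trans (orbit_norm_scale_le _ bf))// f0 mulr0.
- move=> a _ [f [qf f0 ->]]; apply/closure_approx => e e0.
  have [g qg ge] := approx a (iota f) e e0.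
  have qgf := quasi_continuous_convolution hX qg qf.
  exists (iota (convolution g f)).
    exists (convolution g f); split=> //; apply: orbit_norm_eq0 => //.
    apply: le_trans (orbit_norm_convolution (quasi_continuous_bounded qg)
      (quasi_continuous_bounded qf)) _.
    by rewrite f0 mulr0.
  rewrite (hom_mul hom qg qf) -cmulBl.
  exact: le_lt_trans (cmul_norm _ _) ge.
- move=> _ a [f [qf f0 ->]]; apply/closure_approx => e e0.
  have [g qg ge] := approx a (iota f) e e0.
  have qfg := quasi_continuous_convolution hX qf qg.
  exists (iota (convolution f g)).
    exists (convolution f g); split=> //; apply: orbit_norm_eq0 => //.
    apply: le_trans (orbit_norm_convolution (quasi_continuous_bounded qf)
      (quasi_continuous_bounded qg)) _.
    by rewrite f0 mul0r.
  rewrite (hom_mul hom qf qg) -cmulBr; apply: le_lt_trans (cmul_norm _ _) _.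
  by rewrite mulrC.
Qed.

(** The orbit norm separates functions on the unit space, and is dominated by the
    norm of the completion. *)
Lemma orbit_kernel_trivially_meeting : trivially_meeting_ideal A orbit_kernel.
Proof.
have idK := orbit_kernel_ideal.
split=> //; apply/seteqP; split=> [b [/closure_approx clb Ab]|_ ->].
  apply: (@C0_image_eq0 _ _ _ _ _ B_max b 2) => // e g e0 cg bg x.
  have [_ [f [qf f0 ->]] bf] := clb e e0.
  have qg := quasi_continuous_unit_ext (H := H) cg.
  have qd : quasi_continuous (fun a => unit_ext g a - f a).
    have := quasi_continuous_linear (-1) qf qg; congr quasi_continuous.
    by apply/funext => a; rewrite mulN1r addrC.
  apply: le_trans (orbit_norm_unit_ext (H := H) x cg) _.
  have gE : unit_ext g = (fun a => (unit_ext g a - f a) + f a).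
    by apply/funext => a; rewrite subrK.
  apply: (@le_trans _ _ (ofR (orbit_norm (fun a => unit_ext g a - f a)))).
    rewrite ofR_le {1}gE.
    apply: le_trans (orbit_normD (quasi_continuous_bounded qd) (quasi_continuous_bounded qf)) _.
    by rewrite f0 addr0.
  apply: le_trans (orbit_norm_le_iota qd) _; rewrite (iotaB B_max qg qf).
  rewrite -(subrKA b) (le_trans (ler_normD _ _))// mulr_natl mulr2n ofRD.
  by rewrite -/(io g) [`|io g - b|]distrC lerD// ltW.
split; first exact: (ideal0 idK).
by rewrite -(embed0 B_max); apply: embed_C0_image; exact: Cc_space0.
Qed.

(** Over the interior of the set of points with isotropy in [U], all arrows of
    [U] are isotropy arrows, and so act on orbits as units do. The witness is a
    bump function on the unit space minus its copy on these arrows; [EL] only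
    sees the first term. *)
Lemma orbit_kernel_not_in_EL_kernel : ~ topologically_free H ->
  exists2 b, orbit_kernel b & EL b <> 0.
Proof.
move=> ntf; have [U [bU Un [x0 x0V]]] : exists U : set H, [/\ bisection U,
    U `<=` ~` @unit_arrows X H & (interior [set x | isotropy x `&` U !=set0]) !=set0].
  apply: contrapT => nU; apply: ntf => U bU Un; apply: contrapT => /eqP/set0P h.
  by apply: nU; exists U.
set V := interior _ in x0V; have oV : open V by exact: open_interior.
have [oU riU siU] := bU.
pose U' := U `&` s @^-1` V.
have oU' : open U'.
  by apply: openI => //; apply: open_comp => // a _; exact: gsrc_continuous.
have bU' : bisection U' by apply: bisectionS bU oU' _; exact: subIsetl.
have iso a : U' a -> r a = s a.
  move=> [Ua Va]; have [c [[sc rc] Uc]] := interior_subset Va.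
  by have <- : c = a by [apply: siU; rewrite ?inE]; rewrite rc sc.
have U'V x : V x -> (s @` U') x.
  move=> Vx; have [c [[sc rc] Uc]] := interior_subset Vx.
  by exists c => //; split=> //; rewrite /preimage /= sc.
have [sg [sgP sgK sgc]] := bisection_section bU'.
have [u [uc [u01 ux0]] [K [cK KV] u0]] := exists_bump (R := R) hX lX oV x0V.
pose g x : C := ofR (u x).
have gc : continuous g by exact: continuous_ofR.
have g0 x : ~ K x -> g x = 0 by move=> /u0 h; rewrite /g h.
have cg : Cc_space g by split=> //; exists K.
pose f2 a : C := if a \in U' then g (s a) else 0.
have f2E a : U' a -> f2 a = g (s a) by move=> Ua; rewrite /f2 mem_set.
have f20 a : ~ U' a -> f2 a = 0 by move=> Ua; rewrite /f2 memNset.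
have cf2 : Cc U' f2.
  split.
    move=> a Ua; have : {for a, continuous (g \o s)}.
      by apply: continuous_comp; [exact: gsrc_continuous | exact: gc].
    rewrite /prop_for /continuous_at /= -(f2E a Ua) => h; apply: cvg_trans h.
    apply: near_eq_cvg.
    by apply: filterS (open_nbhs_nbhs (conj oU' Ua)) => b Ub; rewrite f2E.
  exists (sg @` K); first split.
  - apply: continuous_compact => //; apply: continuous_in_subspaceT => x /set_mem Kx.
    by apply: sgc; apply: U'V; exact: KV.
  - by move=> _ [x Kx <-]; have [] := sgP x (U'V _ (KV _ Kx)).
  - move=> a Ka; have [Ua|/f20//] := pselect (U' a).
    rewrite f2E// g0// => Ks; apply: Ka; exists (s a) => //; exact: sgK.
have qf2 := quasi_continuous_Cc bU' cf2.
have qg := quasi_continuous_unit_ext (H := H) cg.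
have qf := quasi_continuous_linear (-1) qf2 qg.
exists (iota (fun a => -1 * f2 a + unit_ext g a)).
  apply: subset_closure; exists (fun a => -1 * f2 a + unit_ext g a); split=> //.
  have ff2 := quasi_continuous_fibre_finite qf2.
  have ffg := quasi_continuous_fibre_finite qg.
  apply: orbit_norm_vanish => [|xi]; first exact: quasi_continuous_fibre_finite.
  rewrite orbit_op_linear// orbit_op_unit_ext; apply/funext => y.
  suff -> : orbit_op f2 xi y = g y * xi y by rewrite mulN1r addNr.
  rewrite /orbit_op; have [Vy|nVy] := pselect (V y).
    have [Us sy] := sgP y (U'V _ Vy).
    rewrite (@fsum_single _ _ _ (sg y)).
    - by rewrite f2E// sy.
    - by rewrite /= iso.
    - move=> a /= ay na; rewrite f20 ?mul0r// => Ua; apply: na.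
      by rewrite -(sgK _ Ua) -ay iso.
  rewrite g0 ?mul0r; last by move=> /KV.
  apply: fsbig1 => a /= ay; rewrite f20 ?mul0r// => Ua; apply: nVy.
  by rewrite -ay iso//; case: Ua.
have ELf2 : EL (iota f2) = 0.
  have [dW bW ->] := EL_Cc_unit EL_can bU' cf2.
  apply/eqP; rewrite -normr_le0; apply/(mloc_norm M_loc dW bW _) => //.
  move=> x _; rewrite /= f20 ?normr0// => -[Ux _].
  by apply: (Un _ Ux); exists x.
rewrite (iota_linear B_max)// (EL_linear EL_can) ELf2 scaler0 add0r => EL0'.
have := EL_embed_ge M_loc EL_can x0 cg; rewrite /embed EL0' normr0 /g ux0 ofR1 normr1.
by rewrite ler10.
Qed.

Lemma hidden_ideal_free (N : set B) : N `<=` [set b | EL b = 0] ->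
  hidden_ideal A N -> topologically_free H.
Proof.
move=> NEL [_ Nuniq]; apply: contrapT => /orbit_kernel_not_in_EL_kernel [b Kb ELb].
have [J Jmax KJ] := trivially_meeting_maximal hX lX B_max M_loc EL_can
  orbit_kernel_trivially_meeting.
by apply: ELb; apply: NEL; rewrite (Nuniq _ Jmax); exact: KJ.
Qed.

End IntersectionImpliesFree.

Theorem theorem7p28 (R : realType) (X : topologicalType)
    (X_hausdorff : hausdorff_space X)
    (X_locally_compact : locally_compact [set: X])
    (H : etaleGroupoid X)
    (B : cstarAlgebra R) (iota : (H -> Cplx R) -> B)
    (B_max : is_max_completion iota)
    (M : cstarAlgebra R) (j : set X -> (X -> Cplx R) -> M)
    (M_loc : is_local_multiplier_algebra j)
    (EL : B -> M) (EL_canonical : is_EL iota j EL)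
    (N_EL : set B)
    (N_EL_largest : largest_ideal_in [set b | EL b = 0] N_EL) :
  (generalised_intersection_property (C0_image iota) /\
   hidden_ideal (C0_image iota) N_EL)
  <-> topologically_free H.
Proof.
split=> [[_ hN]|tf].
  have [_ NEL _] := N_EL_largest.
  exact: (hidden_ideal_free X_hausdorff X_locally_compact B_max M_loc EL_canonical NEL hN).
have hN := free_hidden_ideal X_hausdorff X_locally_compact B_max M_loc EL_canonical
  N_EL_largest tf.
by split=> //; exists N_EL.
Qed.
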